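(* Let $C\subseteq\mathbb{A}^2$ be an irreducible reduced curve over $\mathbb{R}$ that is not a line, with normalization $\pi\colon X\to C$, let $\xi\in X(\mathbb{R})$, let $A_\xi=\mathcal{O}_{X,\xi}$, and consider the tangent tensor $T=T_s(x,y)$ of $C$ as an element of $A_\xi\otimes A_\xi$. Let $(m,n)=(m_\xi,n_\xi)$. Then, for any local uniformizer $t\in A_\xi$, there is a choice of sign $\pm$ such that $$\pm T=(1\otimes t^{m-1})\cdot\sum_{i=0}^{n-2}(t^i\otimes t^{n-2-i})\cdot\bigl(\alpha_i\,\delta(u_1)^2+\beta_i\,\delta(u_2)^2\bigr)$$ in $A_\xi\otimes A_\xi$, with elements $u_1,u_2\in A_\xi$ and $\alpha_i,\beta_i\in A_\xi\otimes A_\xi$ such that $\overline{\alpha_i},\overline{\beta_i}>0$ in $\mathbb{R}$ for all $i$.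
   Context: All tensor products are over $\mathbb{R}$. The affine coordinates $x,y$ of $\mathbb{A}^2$ are viewed, via $\pi$, as regular functions on $X$. Let $X_0\subseteq X$ be an affine open neighborhood of $\xi$, with coordinate ring $A=\mathbb{R}[X_0]$, so small that the $A$-module of Kähler differentials $\Omega_{A/\mathbb{R}}$ is freely generated by $ds$ for some $s\in A$; fix such an $s$. For $f\in A$, $\frac{df}{ds}\in A$ is defined by $df=\frac{df}{ds}\,ds$. For $f\in A$ (or $A_\xi$) put $\delta(f)=f\otimes1-1\otimes f$. $A\otimes A$ is regarded as an $A$-algebra via $a\mapsto1\otimes a$, i.e. $a\theta:=(1\otimes a)\theta$. The tangent tensor (relative to $s$) is $$T_s(x,y)=\frac{dx}{ds}\cdot\delta(y)-\frac{dy}{ds}\cdot\delta(x)=\Bigl(1\otimes\frac{dx}{ds}\Bigr)\delta(y)-\Bigl(1\otimes\frac{dy}{ds}\Bigr)\delta(x)\in A\otimes A.$$ Let $val_\xi\colon\mathbb{R}(X)^*\to\mathbb{Z}$ be the discrete valuation of the function field centered at $\xi$; a local uniformizer is an element $t\in A_\xi$ with $val_\xi(t)=1$. The integers $1\le m_\xi<n_\xi$ are the unique ones with $\{0,m_\xi,n_\xi\}=\{val_\xi(f)\colon0\ne f\in\mathbb{R}+\mathbb{R}x+\mathbb{R}y\}$ (here $1,x,y$ are linearly independent since $C$ is not a line). For $\alpha\in A_\xi\otimes A_\xi$, $\overline{\alpha}\in\mathbb{R}$ denotes the evaluation of $\alpha$ at $(\xi,\xi)$, i.e. the image of $\alpha$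 under $p\otimes q\mapsto p(\xi)q(\xi)$. *)

(* Defs.v *)
From HB Require Import structures.
From mathcomp Require Import all_boot all_order all_algebra.
From mathcomp Require Import boolp classical_sets reals.

Set Implicit Arguments.
Unset Strict Implicit.
Unset Printing Implicit Defensive.

Import Order.TTheory GRing.Theory Num.Theory.
Local Open Scope quotient_scope.
Local Open Scope ring_scope.

Reserved Notation "a \ox b" (at level 40, left associativity).

(* The carrier is the set of formal sums of pairs [(a, b)], modulo the additive
   congruence generated by the bilinearity relations.  No formal coefficients
   are needed, because [c *: (a, b)] can be written [(c *: a, b)]. *)
Section Tensor.
Variables (R : comNzRingType) (A B : comAlgType R).

Inductive tens_rel : seq (A * B) -> seq (A * B) -> Prop :=
| tens_refl l : tens_rel l l
| tens_sym l1 l2 : tens_rel l1 l2 -> tens_rel l2 l1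
| tens_trans l1 l2 l3 : tens_rel l1 l2 -> tens_rel l2 l3 -> tens_rel l1 l3
| tens_cat l1 l1' l2 l2' : tens_rel l1 l1' -> tens_rel l2 l2' ->
    tens_rel (l1 ++ l2) (l1' ++ l2')
| tens_comm l1 l2 : tens_rel (l1 ++ l2) (l2 ++ l1)
| tens_nil b : tens_rel [:: (0, b)] [::]
| tens_addl a a' b : tens_rel [:: (a + a', b)] [:: (a, b); (a', b)]
| tens_addr a b b' : tens_rel [:: (a, b + b')] [:: (a, b); (a, b')]
| tens_scale c a b : tens_rel [:: (c *: a, b)] [:: (a, c *: b)].

Definition tens_eqv (l1 l2 : seq (A * B)) : bool := `[< tens_rel l1 l2 >].

Lemma tens_eqv_refl : reflexive tens_eqv.
Proof. by move=> l; apply/asboolP/tens_refl. Qed.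

Lemma tens_eqv_sym : symmetric tens_eqv.
Proof. by move=> l1 l2; apply/asboolP/asboolP => /tens_sym. Qed.

Lemma tens_eqv_trans : transitive tens_eqv.
Proof.
by move=> l2 l1 l3 /asboolP h12 /asboolP h23; apply/asboolP/(tens_trans h12).
Qed.

Canonical tens_equiv := EquivRel tens_eqv tens_eqv_refl tens_eqv_sym tens_eqv_trans.

Definition tensor := {eq_quot tens_eqv}.
HB.instance Definition _ : EqQuotient _ tens_eqv tensor := EqQuotient.on tensor.
HB.instance Definition _ := Choice.on tensor.

Implicit Types (l : seq (A * B)) (u v w : tensor).

Definition tens_sum l : tensor := \pi_tensor l.
Definition tens (a : A) (b : B) : tensor := tens_sum [:: (a, b)].
Local Notation "a \ox b" := (tens a b).

Lemma tens_sumP l1 l2 : tens_sum l1 = tens_sum l2 <-> tens_rel l1 l2.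
Proof.
split=> [h|h]; first by apply/asboolP; move/eqmodP: h.
by apply/eqmodP; apply/asboolP.
Qed.

Lemma tens_sum_repr u : tens_sum (repr u) = u.
Proof. exact: reprK. Qed.

Definition tens_opp_seq l := [seq (- p.1, p.2) | p <- l].

Definition tens_zero : tensor := tens_sum [::].
Definition tens_add u v : tensor := tens_sum (repr u ++ repr v).
Definition tens_opp u : tensor := tens_sum (tens_opp_seq (repr u)).

Lemma tens_add_sum l1 l2 :
  tens_add (tens_sum l1) (tens_sum l2) = tens_sum (l1 ++ l2).
Proof.
by apply/tens_sumP; apply: tens_cat; apply/tens_sumP; rewrite tens_sum_repr.
Qed.

Lemma tens_addA : associative tens_add.
Proof.
move=> u v w; rewrite -(tens_sum_repr u) -(tens_sum_repr v) -(tens_sum_repr w).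
by rewrite !tens_add_sum catA.
Qed.

Lemma tens_addC : commutative tens_add.
Proof. by move=> u v; apply/tens_sumP/tens_comm. Qed.

Lemma tens_add0 : left_id tens_zero tens_add.
Proof. by move=> u; rewrite -(tens_sum_repr u) tens_add_sum. Qed.

Lemma tens_addNpure a b : tens_add ((- a) \ox b) (a \ox b) = tens_zero.
Proof.
rewrite tens_add_sum; apply/tens_sumP; apply: tens_trans (tens_nil b).
by have := tens_addl (- a) a b; rewrite addNr => /tens_sym.
Qed.

Lemma tens_opp_sum l : tens_add (tens_sum (tens_opp_seq l)) (tens_sum l) = tens_zero.
Proof.
elim: l => [|[a b] l IH]; first by rewrite tens_add_sum.
rewrite /= -[_ :: tens_opp_seq l]cat1s -(cat1s (a, b)) -!tens_add_sum.
rewrite -tens_addA (tens_addA (tens_sum (tens_opp_seq l))).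
rewrite (tens_addC (tens_sum (tens_opp_seq l))) -tens_addA IH tens_addA.
by rewrite tens_addNpure tens_add0.
Qed.

Lemma tens_addN : left_inverse tens_zero tens_opp tens_add.
Proof.
move=> u; rewrite -[in X in tens_add _ X](tens_sum_repr u).
exact: tens_opp_sum.
Qed.

HB.instance Definition _ := GRing.isZmodule.Build tensor
  tens_addA tens_addC tens_add0 tens_addN.

Lemma tens_sumE l : tens_sum l = \sum_(p <- l) p.1 \ox p.2.
Proof.
elim: l => [|[a b] l IH]; first by rewrite big_nil.
by rewrite big_cons -IH -[RHS]/(tens_add _ _) tens_add_sum.
Qed.

Lemma tensDl a a' b : (a + a') \ox b = a \ox b + a' \ox b.
Proof. by rewrite -[RHS]/(tens_add _ _) tens_add_sum; apply/tens_sumP/tens_addl. Qed.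

Lemma tensDr a b b' : a \ox (b + b') = a \ox b + a \ox b'.
Proof. by rewrite -[RHS]/(tens_add _ _) tens_add_sum; apply/tens_sumP/tens_addr. Qed.

Lemma tensZ c a b : (c *: a) \ox b = a \ox (c *: b).
Proof. exact/tens_sumP/tens_scale. Qed.

Lemma tens0l b : 0 \ox b = 0.
Proof. exact/tens_sumP/tens_nil. Qed.

Lemma tens_ind (P : tensor -> Prop) :
  P 0 -> (forall a b u, P u -> P (a \ox b + u)) -> forall u, P u.
Proof.
move=> P0 PD u; rewrite -(tens_sum_repr u) tens_sumE.
by elim: (repr u) => [|p l IH]; rewrite ?big_nil ?big_cons //; apply: PD.
Qed.

Definition balanced (V : zmodType) (phi : A -> B -> V) : Prop :=
  [/\ forall a a' b, phi (a + a') b = phi a b + phi a' b,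
      forall a b b', phi a (b + b') = phi a b + phi a b' &
      forall c a b, phi (c *: a) b = phi a (c *: b)].

(* The additive map induced by [phi]; it is meaningful only for balanced [phi]. *)
Definition tens_lift (V : zmodType) (phi : A -> B -> V) (u : tensor) : V :=
  \sum_(p <- repr u) phi p.1 p.2.

Section Lift.
Variables (V : zmodType) (phi : A -> B -> V).
Hypothesis phiB : balanced phi.

Lemma tens_lift_rel l1 l2 : tens_rel l1 l2 ->
  \sum_(p <- l1) phi p.1 p.2 = \sum_(p <- l2) phi p.1 p.2.
Proof.
case: phiB => phiDl phiDr phiZ.
elim=> {l1 l2} [//|l1 l2 _ -> //|l1 l2 l3 _ -> _ //|l1 l1' l2 l2' _ h1 _ h2|l1 l2
  |b|a a' b|a b b'|c a b].
- by rewrite !big_cat /= h1 h2.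
- by rewrite !big_cat /= addrC.
- rewrite big_seq1 big_nil /=; apply: (addrI (phi 0 b)).
  by rewrite addr0 -phiDl addr0.
- by rewrite !(big_cons, big_nil) /= !addr0 phiDl.
- by rewrite !(big_cons, big_nil) /= !addr0 phiDr.
- by rewrite !big_seq1 /= phiZ.
Qed.

Lemma tens_lift_sum l : tens_lift phi (tens_sum l) = \sum_(p <- l) phi p.1 p.2.
Proof. by apply: tens_lift_rel; apply/tens_sumP; rewrite tens_sum_repr. Qed.

Lemma tens_liftE a b : tens_lift phi (a \ox b) = phi a b.
Proof. by rewrite tens_lift_sum big_seq1. Qed.

Lemma tens_liftD u v : tens_lift phi (u + v) = tens_lift phi u + tens_lift phi v.
Proof.
rewrite -(tens_sum_repr u) -(tens_sum_repr v) -[_ + _]/(tens_add _ _).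
by rewrite tens_add_sum !tens_lift_sum big_cat.
Qed.

Lemma tens_lift0 : tens_lift phi 0 = 0.
Proof. by rewrite -[0]/(tens_sum [::]) tens_lift_sum big_nil. Qed.

End Lift.

Definition tens_mul1 (a : A) (b : B) : tensor -> tensor :=
  tens_lift (fun a' b' => (a * a') \ox (b * b')).
Definition tens_mul (u v : tensor) : tensor :=
  tens_lift (fun a b => tens_mul1 a b v) u.
Definition tens_one : tensor := 1 \ox 1.

Lemma tens_mul1_balanced a b : balanced (fun a' b' => (a * a') \ox (b * b')).
Proof.
by split=> [*|*|c *]; rewrite ?mulrDr ?tensDl ?tensDr // -!scalerAr tensZ.
Qed.

Lemma tens_mul1E a b a' b' : tens_mul1 a b (a' \ox b') = (a * a') \ox (b * b').
Proof. exact: (tens_liftE (tens_mul1_balanced a b)). Qed.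

Lemma tens_mul1D a b u v :
  tens_mul1 a b (u + v) = tens_mul1 a b u + tens_mul1 a b v.
Proof. exact: (tens_liftD (tens_mul1_balanced a b)). Qed.

Lemma tens_mul10 a b : tens_mul1 a b 0 = 0.
Proof. exact: (tens_lift0 (tens_mul1_balanced a b)). Qed.

Lemma tens_mul_balanced v : balanced (fun a b => tens_mul1 a b v).
Proof.
elim/tens_ind: v => [|a0 b0 v [h1 h2 h3]].
  by split=> *; rewrite !tens_mul10 ?addr0.
split=> [a a' b|a b b'|c a b]; rewrite !tens_mul1D !tens_mul1E.
- by rewrite h1 mulrDl tensDl addrACA.
- by rewrite h2 mulrDl tensDr addrACA.
- by rewrite h3 -!scalerAl tensZ.
Qed.

Lemma tens_mulDl : left_distributive tens_mul +%R.
Proof. by move=> u v w; rewrite /tens_mul (tens_liftD (tens_mul_balanced w)). Qed.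

Lemma tens_mul0l v : tens_mul 0 v = 0.
Proof. exact: (tens_lift0 (tens_mul_balanced v)). Qed.

Lemma tens_mul_pure a b v : tens_mul (a \ox b) v = tens_mul1 a b v.
Proof. exact: (tens_liftE (tens_mul_balanced v)). Qed.

Lemma tens_mulE a b a' b' : tens_mul (a \ox b) (a' \ox b') = (a * a') \ox (b * b').
Proof. by rewrite tens_mul_pure tens_mul1E. Qed.

Lemma tens_mulDr : right_distributive tens_mul +%R.
Proof.
move=> u v w; elim/tens_ind: u => [|a b u IH]; first by rewrite !tens_mul0l addr0.
by rewrite !tens_mulDl IH !tens_mul_pure tens_mul1D addrACA.
Qed.

Lemma tens_mul0r v : tens_mul v 0 = 0.
Proof.
elim/tens_ind: v => [|a b u IH]; first exact: tens_mul0l.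
by rewrite tens_mulDl IH tens_mul_pure tens_mul10 addr0.
Qed.

Lemma tens_mulC : commutative tens_mul.
Proof.
move=> u v; elim/tens_ind: u => [|a b u IH]; first by rewrite tens_mul0l tens_mul0r.
rewrite tens_mulDl tens_mulDr IH; congr (_ + _).
elim/tens_ind: v {IH} => [|a' b' v IH]; first by rewrite tens_mul0l tens_mul0r.
by rewrite tens_mulDl tens_mulDr IH !tens_mulE [a * a']mulrC [b * b']mulrC.
Qed.

Lemma tens_mulA : associative tens_mul.
Proof.
move=> u v w; elim/tens_ind: u => [|a b u IH]; first by rewrite !tens_mul0l.
rewrite !tens_mulDl IH; congr (_ + _).
elim/tens_ind: v {IH} => [|a' b' v IH]; first by rewrite !(tens_mul0l, tens_mul0r).
rewrite !(tens_mulDl, tens_mulDr) IH; congr (_ + _).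
elim/tens_ind: w {IH} => [|a'' b'' w IH]; first by rewrite !tens_mul0r.
by rewrite !tens_mulDr IH !tens_mulE !mulrA.
Qed.

Lemma tens_mul1l : left_id tens_one tens_mul.
Proof.
elim/tens_ind=> [|a b u IH]; first by rewrite tens_mul0r.
by rewrite tens_mulDr IH tens_mulE !mul1r.
Qed.

HB.instance Definition _ := GRing.Zmodule_isComPzRing.Build tensor
  tens_mulA tens_mulC tens_mul1l tens_mulDl.

Lemma tensM a b a' b' : (a \ox b) * (a' \ox b') = (a * a') \ox (b * b').
Proof. exact: tens_mulE. Qed.

Lemma tens11 : 1 \ox 1 = 1 :> tensor.
Proof. by []. Qed.

End Tensor.

Notation "a \ox b" := (tens a b) : ring_scope.

(* [I] is the kernel of the multiplication map [A \ox A -> A]; the module of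
   Kaehler differentials is [I / I^2], on which [a : A] acts as multiplication by
   [1 \ox a], and [df] is the class of [delta f]. *)
Section Kaehler.
Variables (R : comNzRingType) (A : comAlgType R).
Implicit Types (s f a x y : A) (w : tensor A A).

Definition delta f : tensor A A := f \ox 1 - 1 \ox f.

Definition tens_prod : tensor A A -> A := tens_lift (fun a b => a * b).

Lemma tens_prod_balanced : balanced (fun a b : A => a * b).
Proof. by split=> [*|*|*]; rewrite ?mulrDl ?mulrDr // -scalerAl -scalerAr. Qed.

Definition in_diag w : Prop := tens_prod w = 0.

Definition in_diag2 w : Prop :=
  exists l : seq (tensor A A * tensor A A),
    (forall p, p \in l -> in_diag p.1 /\ in_diag p.2) /\
    w = \sum_(p <- l) p.1 * p.2.

Definition kaehler_free s : Prop :=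
  forall w, in_diag w -> exists! a, in_diag2 (w - (1 \ox a) * delta s).

(* The element [df/ds]: it is unique when [kaehler_free s] holds. *)
Definition ddiff s f : A := xget 0 [set a | in_diag2 (delta f - (1 \ox a) * delta s)].

Definition tangent_tensor s x y : tensor A A :=
  (1 \ox ddiff s x) * delta y - (1 \ox ddiff s y) * delta x.

End Kaehler.

Definition tens_map (R : comNzRingType) (A B : comAlgType R) (f : A -> B) :
    tensor A A -> tensor B B :=
  tens_lift (fun a b => f a \ox f b).

Lemma tens_map_balanced (R : comNzRingType) (A B : comAlgType R)
  (f : {linear A -> B}) : balanced (fun a b => f a \ox f b).
Proof. by split=> *; rewrite ?linearD ?linearZ ?tensDl ?tensDr //= tensZ. Qed.

#[short(type="fieldAlgType")]
HB.structure Definition FieldAlgebra (R : nzRingType) :=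
  {K of GRing.ComUnitAlgebra R K & GRing.Field K}.

(* Bivariate polynomials are [{poly {poly R}}]: the inner indeterminate stands for
   [x], the outer one for [y]. *)
Section PlaneCurve.
Variable R : realType.

Definition irreducible_elt (D : idomainType) (F : D) : Prop :=
  [/\ F != 0, F \isn't a GRing.unit &
      forall G H : D, F = G * H -> G \is a GRing.unit \/ H \is a GRing.unit].

Definition is_line (F : {poly {poly R}}) : Prop :=
  exists a b c : R, F = (a *: 'X)%:P + b%:P *: 'X + c%:P%:P.

Variable K : fieldAlgType R.

Definition bieval (x y : K) : {poly {poly R}} -> K :=
  horner_eval y \o map_poly (horner_alg x).
HB.instance Definition _ x y := GRing.RMorphism.on (bieval x y).

(* [K] is the fraction field of [R[x, y] / (F)], with [x] and [y] the classes of
   the two indeterminates. *)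
Definition function_field (F : {poly {poly R}}) (x y : K) : Prop :=
  (forall G, bieval x y G = 0 <-> exists H, G = H * F) /\
  (forall z, exists G H, bieval x y H != 0 /\ z = bieval x y G / bieval x y H).

End PlaneCurve.

Section Normalization.
Variables (R : realType) (K : fieldAlgType R) (x y : K).

Definition integral_closure : {pred K} :=
  [pred z | `[< integralOver (bieval x y) z >]].

Lemma integral_closureP z :
  reflect (integralOver (bieval x y) z) (z \in integral_closure).
Proof. exact: asboolP. Qed.

Lemma bieval_integral G : bieval x y G \in integral_closure.
Proof. exact/integral_closureP/integral_id. Qed.

Lemma bievalX : bieval x y 'X%:P = x.
Proof. by rewrite /bieval /= map_polyC /horner_eval hornerC /= horner_algX. Qed.

Lemma bievalY : bieval x y 'X = y.
Proof. by rewrite /bieval /= map_polyX /horner_eval hornerX. Qed.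

Lemma bievalC c : bieval x y c%:P%:P = c%:A.
Proof. by rewrite /bieval /= map_polyC /horner_eval hornerC /= horner_algC. Qed.

Lemma integral_closure_subalg : subalg_closed integral_closure.
Proof.
split=> [|c u v /integral_closureP hu /integral_closureP hv|u v
          /integral_closureP hu /integral_closureP hv]; apply/integral_closureP.
- exact: integral1.
- rewrite -mulr_algl -bievalC; apply: integral_add => //; apply: integral_mul => //.
  exact: integral_id.
- exact: integral_mul.
Qed.

HB.instance Definition _ := GRing.isSubalgClosed.Build R K integral_closure
  integral_closure_subalg.

Record nring := NRing { nring_val :> K; nring_valP : nring_val \in integral_closure }.
HB.instance Definition _ := [isSub for nring_val].
HB.instance Definition _ := [Choice of nring by <:].
HB.instance Definition _ := [SubChoice_isSubComNzRing of nring by <:].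
HB.instance Definition _ := [SubZmodule_isSubLmodule of nring by <:].
HB.instance Definition _ := [SubNzRing_SubLmodule_isSubLalgebra of nring by <:].
HB.instance Definition _ := [SubLalgebra_isSubAlgebra of nring by <:].

Lemma nring_x_proof : x \in integral_closure.
Proof. by rewrite -{1}bievalX bieval_integral. Qed.

Lemma nring_y_proof : y \in integral_closure.
Proof. by rewrite -{1}bievalY bieval_integral. Qed.

(* [R[X]] is the integral closure of [R[C]] in the function field, so that a real
   point of [X] is a morphism of [R]-algebras [R[X] -> R]. *)
Definition real_point := {lrmorphism nring -> R^o}.

(* The open subset [D(E)] of [X] where some element of [E] does not vanish: it is
    the union of the basic open sets [D(e)], on which the regular functions are the
    elements of [R[X][1/e]]. *)
Section OpenSubset.
Variable E : set nring.

Definition regular_on : {pred K} :=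
  [pred z | `[< forall e, E e -> e != 0 ->
                exists N, val e ^+ N * z \in integral_closure >]].

Lemma regular_onP z : reflect
  (forall e, E e -> e != 0 -> exists N, val e ^+ N * z \in integral_closure)
  (z \in regular_on).
Proof. exact: asboolP. Qed.

Lemma integral_closure_regular z : z \in integral_closure -> z \in regular_on.
Proof. by move=> hz; apply/regular_onP => e _ _; exists 0; rewrite mul1r. Qed.

Lemma regular_on_subalg : subalg_closed regular_on.
Proof.
split=> [|c u v /regular_onP hu /regular_onP hv|u v
          /regular_onP hu /regular_onP hv].
- exact/integral_closure_regular/rpred1.
- apply/regular_onP => e Ee e0; have [M hM] := hu e Ee e0; have [N hN] := hv e Ee e0.
  exists (M + N)%N; rewrite mulrDr -scalerAr rpredD // ?rpredZ //.
    by rewrite exprD mulrAC rpredM // rpredX // nring_valP.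
  by rewrite exprD -mulrA rpredM // rpredX // nring_valP.
- apply/regular_onP => e Ee e0; have [M hM] := hu e Ee e0; have [N hN] := hv e Ee e0.
  by exists (M + N)%N; rewrite exprD mulrACA rpredM.
Qed.

HB.instance Definition _ := GRing.isSubalgClosed.Build R K regular_on
  regular_on_subalg.

Record open_ring := OpenRing { open_val :> K; open_valP : open_val \in regular_on }.
HB.instance Definition _ := [isSub for open_val].
HB.instance Definition _ := [Choice of open_ring by <:].
HB.instance Definition _ := [SubChoice_isSubComNzRing of open_ring by <:].
HB.instance Definition _ := [SubZmodule_isSubLmodule of open_ring by <:].
HB.instance Definition _ := [SubNzRing_SubLmodule_isSubLalgebra of open_ring by <:].
HB.instance Definition _ := [SubLalgebra_isSubAlgebra of open_ring by <:].

Definition open_x : open_ring := OpenRing (integral_closure_regular nring_x_proof).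
Definition open_y : open_ring := OpenRing (integral_closure_regular nring_y_proof).

(* [D(E)] is affine if and only if [E] generates the unit ideal of its ring of
   regular functions. *)
Definition affine_open : Prop :=
  exists l : seq (nring * open_ring),
    (forall p, p \in l -> E p.1) /\ 1 = \sum_(p <- l) val p.1 * val p.2.

End OpenSubset.

Section LocalRing.
Variable xi : real_point.

Definition local_at : {pred K} :=
  [pred z | `[< exists a b : nring, xi b != 0 /\ z = val a / val b >]].

Lemma local_atP z : reflect
  (exists a b : nring, xi b != 0 /\ z = val a / val b) (z \in local_at).
Proof. exact: asboolP. Qed.

Lemma xi_neq0 b : xi b != 0 -> val b != 0 :> K.
Proof. by apply: contraNneq => b0; rewrite (_ : b = 0) ?rmorph0 //; apply: val_inj. Qed.

Lemma local_at_subalg : subalg_closed local_at.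
Proof.
split=> [|c u v /local_atP[a [b [hb ->]]] /local_atP[a' [b' [hb' ->]]]|u v
          /local_atP[a [b [hb ->]]] /local_atP[a' [b' [hb' ->]]]]; apply/local_atP.
- by exists 1, 1; rewrite rmorph1 oner_neq0 divr1.
- exists (c *: (a * b') + a' * b), (b * b'); rewrite rmorphM mulf_neq0 //; split=> //.
  rewrite scalerAl addf_div ?xi_neq0 //; congr (_ / _).
  by rewrite -[RHS]/(c *: (val a * val b') + val a' * val b) scalerAl.
- exists (a * a'), (b * b'); rewrite rmorphM mulf_neq0 //; split=> //.
  by rewrite !rmorphM /= mulf_div.
Qed.

HB.instance Definition _ := GRing.isSubalgClosed.Build R K local_at local_at_subalg.

Record local_ring := LocalRing { local_val :> K; local_valP : local_val \in local_at }.
HB.instance Definition _ := [isSub for local_val].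
HB.instance Definition _ := [Choice of local_ring by <:].
HB.instance Definition _ := [SubChoice_isSubComNzRing of local_ring by <:].
HB.instance Definition _ := [SubZmodule_isSubLmodule of local_ring by <:].
HB.instance Definition _ := [SubNzRing_SubLmodule_isSubLalgebra of local_ring by <:].
HB.instance Definition _ := [SubLalgebra_isSubAlgebra of local_ring by <:].

Definition eval_at (z : K) : R :=
  xget 0 [set c | exists a b : nring,
                    [/\ xi b != 0, z = val a / val b & c = xi a / xi b]].

Lemma eval_atE (a b : nring) : xi b != 0 -> eval_at (val a / val b) = xi a / xi b.
Proof.
move=> hb; rewrite /eval_at; case: xgetP => [c _ /= [a' [b' [hb' eq ->]]]|]; last first.
  by move=> /(_ (xi a / xi b))/=; case; exists a, b.
apply/eqP; rewrite eqr_div // -!rmorphM; apply/eqP; congr (xi _); apply: val_inj.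
by rewrite !rmorphM /=; move/eqP: eq; rewrite eq_sym eqr_div ?xi_neq0 // => /eqP.
Qed.

Lemma eval_atD z w : z \in local_at -> w \in local_at ->
  eval_at (z + w) = eval_at z + eval_at w.
Proof.
move=> /local_atP[a [b [hb ->]]] /local_atP[a' [b' [hb' ->]]].
have h : val a / val b + val a' / val b' = val (a * b' + a' * b) / val (b * b').
  by rewrite addf_div ?xi_neq0.
rewrite h eval_atE ?eval_atE //; last by rewrite rmorphM mulf_neq0.
by rewrite addf_div // rmorphD !rmorphM.
Qed.

Lemma eval_atM z w : z \in local_at -> w \in local_at ->
  eval_at (z * w) = eval_at z * eval_at w.
Proof.
move=> /local_atP[a [b [hb ->]]] /local_atP[a' [b' [hb' ->]]].
have h : val a / val b * (val a' / val b') = val (a * a') / val (b * b').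
  by rewrite mulf_div.
rewrite h eval_atE ?eval_atE //; last by rewrite rmorphM mulf_neq0.
by rewrite mulf_div !rmorphM.
Qed.

Lemma eval_atZ c z : z \in local_at -> eval_at (c *: z) = c * eval_at z.
Proof.
move=> /local_atP[a [b [hb ->]]].
by rewrite scalerAl -[c *: val a]/(val (c *: a)) !eval_atE // linearZ /= mulrA.
Qed.

Lemma eval_at2_balanced :
  balanced (fun p q : local_ring => eval_at (val p) * eval_at (val q)).
Proof.
split=> [a a' b|a b b'|c a b].
- by rewrite -mulrDl -eval_atD ?local_valP.
- by rewrite -mulrDr -eval_atD ?local_valP.
- rewrite -[val (c *: a)]/(c *: val a) -[val (c *: b)]/(c *: val b).
  by rewrite !eval_atZ ?local_valP // mulrCA mulrA.
Qed.

(* Evaluation at [(xi, xi)]. *)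
Definition eval_at2 : tensor local_ring local_ring -> R :=
  tens_lift (fun p q : local_ring => eval_at (val p) * eval_at (val q)).

Record affine_nbhd := AffineNbhd {
  nbhd_eqns : set nring;
  nbhd_affine : affine_open nbhd_eqns;
  nbhd_point : exists2 e, nbhd_eqns e & xi e != 0 }.

Definition coord_ring (U : affine_nbhd) := open_ring (nbhd_eqns U).

Lemma regular_local (U : affine_nbhd) z : z \in regular_on (nbhd_eqns U) -> z \in local_at.
Proof.
have [e Ee xie] := nbhd_point U; move=> /regular_onP/(_ e Ee) h.
have e0 : val e != 0 := xi_neq0 xie.
have [|N hN] := h; first by apply: contraNneq xie => ->; rewrite rmorph0.
apply/local_atP; exists (NRing hN), (e ^+ N); rewrite rmorphXn expf_neq0 //; split=> //.
by rewrite rmorphXn /= mulrC mulKf ?expf_neq0.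
Qed.

Definition to_local (U : affine_nbhd) (f : coord_ring U) : local_ring :=
  LocalRing (regular_local (open_valP f)).

Lemma to_local_linear (U : affine_nbhd) : linear (@to_local U).
Proof. by move=> c f g; apply: val_inj. Qed.

HB.instance Definition _ (U : affine_nbhd) :=
  GRing.isLinear.Build R (coord_ring U) local_ring _ (@to_local U) (@to_local_linear U).

(* The discrete valuation of [K] with value group [int] whose valuation ring
   dominates the local ring at [xi]; its value at 0 is irrelevant. *)
Record valuation_centered (v : K -> int) : Prop := ValuationCentered {
  valuationM : forall a b, a != 0 -> b != 0 -> v (a * b) = v a + v b;
  valuationD : forall a b, a != 0 -> b != 0 -> a + b != 0 ->
    Num.min (v a) (v b) <= v (a + b);
  valuation_onto : forall k, exists2 a, a != 0 & v a = k;
  valuation_ge0 : forall a, a \in local_at -> a != 0 -> 0 <= v a;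
  valuation_gt0 : forall a, a \in local_at -> a != 0 -> (0 < v a) = (eval_at a == 0) }.

Definition uniformizer (v : K -> int) (t : local_ring) : Prop :=
  t != 0 /\ v (val t) = 1.

End LocalRing.

(* [{0, m, n}] is the set of values of the nonzero elements of [R + R x + R y]. *)
Definition value_set (v : K -> int) (m n : nat) : Prop :=
  [set k | exists a b c : R, let f := a%:A + b *: x + c *: y in
             f != 0 /\ k = v f]%classic = [set 0; m%:Z; n%:Z]%classic.

End Normalization.

(* Main.v *)
From HB Require Import structures.
Require Import Defs.
From mathcomp Require Import all_boot all_order all_algebra.
From mathcomp Require Import polyXY zify ring lra.
From mathcomp Require Import boolp classical_sets reals.

Set Implicit Arguments.
Unset Strict Implicit.
Unset Printing Implicit Defensive.

Import Order.TTheory GRing.Theory Num.Theory.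
Local Open Scope ring_scope.

(** The idea is to find two elements [p], [q] of the local ring [L] at [xi] for which
    [delta p], [delta q] generate the ideal [I] of the diagonal in the tensor square of
    [L], not only near the point [(xi, xi)], and then to expand the tangent tensor in
    powers of [t] with coefficients in [I^2].

    Such [p], [q] come from a plane model of the function field that is smooth at [xi].
    Starting from [(x, y)], one blows up the point repeatedly ([resolution]).  Along the
    process a polynomial relation [G(p, q) = 0] with [G_Y(p, q) <> 0] is carried along.
    If [G_Y] vanishes at the point and [p - p0] has at most the value of [q - q0], then the
    relation has no linear term, its transform is divisible by [(p - p0)^2]
    ([blow_up]), and the value of [G_Y] drops by the value of [p - p0].  If [q - q0] has
    the smaller value the coordinates are exchanged, so the process terminates with
    [G_Y] a unit.  The slope [(q - q0) / (p - p0)] stays in [L]: it is a root of a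
    polynomial over [L] with a unit coefficient and has nonnegative value, and [L] is a
    localization of an integrally closed ring ([unit_coef_root_local]).

    At the end [L] is the localization of [R[p, q]] at the point, and [p - p0] is a
    uniformizer.  Therefore [delta p] and [delta q] generate [I], and [G(p, q) = 0] gives
    [dq = a dp] for some [a].  Multiplying the latter congruence by [delta p] shows that
    [delta p * delta q] is a combination of [delta p ^+ 2] and [delta q ^+ 2], so that
    these two squares generate [I^2] ([mixed_in_squares], [diag_gen2_squares]).

    A linear change of coordinates, which changes the tangent tensor by a constant,
    replaces [x], [y] by [t^m a], [t^n b] with units [a], [b].  With [X = t \ox 1] and
    [Y = 1 \ox t] the tensor is then, up to a unit of the right factor, [Y^(m-1)] times
    [a b (m (X^n - Y^n) - n Y^(n-m) (X^m - Y^m))] plus terms of higher order.  The form in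
    parentheses is [(X - Y)^2] times a form of degree [n - 2] with positive coefficients
    ([double_quotient]), and the remaining terms only change the coefficients by
    elements that vanish at [(xi, xi)] ([tangent_form]).  Each coefficient is thus
    [c * delta p ^+ 2] with [c] of a fixed sign at the point, plus an error; a small
    multiple of the relation between [delta q ^+ 2] and [delta p ^+ 2] makes the
    coefficient of [delta q ^+ 2] positive too ([positive_squares]).

    The derivatives with respect to [s] are related to those with respect to [p] by
    extending [ddiff s] to a derivation of [L] by the quotient rule ([local_derivation]);
    a derivation kills [I^2] and so turns congruences of differentials into equalities
    ([derivation_congr]). *)

(** * Tensor products of algebras *)

Section TensorMorphisms.
Variables (R : comNzRingType) (A B : comAlgType R).

(** Additivity reduces multiplicativity of an induced map to pure tensors. *)
Lemma tens_liftM (S : comPzRingType) (phi : A -> B -> S) : balanced phi ->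
    (forall a b a' b', phi (a * a') (b * b') = phi a b * phi a' b') ->
  {morph tens_lift phi : u v / u * v}.
Proof.
move=> phiB phiM u v; elim/tens_ind: u => [|a b u IH].
  by rewrite mul0r !tens_lift0 // mul0r.
rewrite mulrDl !(tens_liftD phiB) IH mulrDl; congr (_ + _).
elim/tens_ind: v {IH} => [|a' b' v IH]; first by rewrite mulr0 !tens_lift0 // mulr0.
by rewrite mulrDr !(tens_liftD phiB) IH mulrDr tensM !(tens_liftE phiB) phiM.
Qed.

Lemma tens_liftB (V : zmodType) (phi : A -> B -> V) : balanced phi ->
  {morph tens_lift phi : u v / u - v}.
Proof.
by move=> phiB u v; apply/eqP; rewrite eq_sym subr_eq -(tens_liftD phiB) subrK.
Qed.

End TensorMorphisms.

Section Diagonal.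
Variables (R : comNzRingType) (A : comAlgType R).
Implicit Types (f g : A) (w : tensor A A).

Lemma tens_prodE f g : tens_prod (f \ox g) = f * g.
Proof. exact: (tens_liftE (@tens_prod_balanced _ A)). Qed.

Lemma tens_prodB : {morph @tens_prod _ A : u v / u - v}.
Proof. exact: (tens_liftB (@tens_prod_balanced _ A)). Qed.

Lemma tens_prodM : {morph @tens_prod _ A : u v / u * v}.
Proof. by apply: (tens_liftM (@tens_prod_balanced _ A)) => *; rewrite mulrACA. Qed.

Lemma tens_prod1 : tens_prod 1 = 1 :> A.
Proof. by rewrite -tens11 tens_prodE mulr1. Qed.

HB.instance Definition _ := GRing.isZmodMorphism.Build _ _ (@tens_prod R A) tens_prodB.
HB.instance Definition _ := GRing.isMonoidMorphism.Build _ _ (@tens_prod R A)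
  (tens_prod1, tens_prodM).

Lemma tens0r f : f \ox (0 : A) = 0 :> tensor A A.
Proof. by rewrite -(scale0r (0 : A)) -tensZ scale0r tens0l. Qed.

Lemma tensNr f g : f \ox (- g) = - (f \ox g).
Proof. by apply/eqP; rewrite -addr_eq0 -tensDr addNr tens0r. Qed.

Lemma tensXn f g k : (f \ox g) ^+ k = (f ^+ k) \ox (g ^+ k).
Proof. by elim: k => // k IH; rewrite !exprS IH tensM. Qed.

Lemma tens_split f g : f \ox g = (f \ox 1) * (1 \ox g).
Proof. by rewrite tensM mulr1 mul1r. Qed.

Lemma tensrM f g : 1 \ox (f * g) = (1 \ox f) * (1 \ox g) :> tensor A A.
Proof. by rewrite tensM mulr1. Qed.

Lemma deltaD f g : delta (f + g) = delta f + delta g.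
Proof. by rewrite /delta tensDl tensDr; ring. Qed.

Lemma deltaM f g :
  delta (f * g) = (1 \ox f) * delta g + (1 \ox g) * delta f + delta f * delta g.
Proof.
rewrite /delta tensrM (_ : (f * g) \ox 1 = (f \ox 1) * (g \ox 1)); first by ring.
by rewrite tensM mulr1.
Qed.

Lemma delta_alg (c : R) : delta (c%:A : A) = 0.
Proof. by rewrite /delta tensZ subrr. Qed.

Lemma delta_diag f : in_diag (delta f).
Proof. by rewrite /in_diag /delta tens_prodB !tens_prodE mulr1 mul1r subrr. Qed.

(** In [f \ox g = (f \ox 1) * (1 \ox g)] replace [f \ox 1] by [1 \ox f + delta f].
    Hence the elements [delta f] generate the kernel of the multiplication. *)
Lemma diag_decomposition w : exists l : seq (A * tensor A A),
  w = 1 \ox tens_prod w + \sum_(p <- l) p.2 * delta p.1.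
Proof.
elim/tens_ind: w => [|f g w [l IH]].
  by exists [::]; rewrite big_nil raddf0 tens0r addr0.
exists ((f, 1 \ox g) :: l); rewrite {1}IH big_cons rmorphD /= tens_prodE tensDr tensrM.
by rewrite (tens_split f g) /delta; ring.
Qed.

End Diagonal.

(** * Ideals generated by two elements *)

Section TwoGenerators.
Variable B : comPzRingType.
Implicit Types (M : B -> Prop) (p q a b : B).

Definition is_ideal M :=
  [/\ M 0, forall a b, M a -> M b -> M (a + b) & forall c a, M a -> M (c * a)].

(** The product of the ideal [M] with the ideal generated by [p] and [q]. *)
Definition span2 M p q a := exists c d, [/\ M c, M d & a = c * p + d * q].

Definition unit_ideal : B -> Prop := fun=> True.

Lemma unit_ideal_ideal : is_ideal unit_ideal.
Proof. by split. Qed.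

Lemma span2_ideal M p q : is_ideal M -> is_ideal (span2 M p q).
Proof.
move=> [M0 MD MM]; split=> [|_ _ [a [b [Ma Mb ->]]] [c [d [Mc Md ->]]]|
    e _ [a [b [Ma Mb ->]]]].
- by exists 0, 0; split=> //; ring.
- by exists (a + c), (b + d); split; [apply: MD|apply: MD|ring].
- by exists (e * a), (e * b); split; [apply: MM|apply: MM|ring].
Qed.

Lemma ideal_opp M a : is_ideal M -> M a -> M (- a).
Proof. by move=> [_ _ MM] Ma; rewrite -mulN1r; apply: MM. Qed.

Lemma ideal_sub M a b : is_ideal M -> M a -> M b -> M (a - b).
Proof. by move=> MI Ma Mb; have [_ MD _] := MI; apply: MD => //; apply: ideal_opp. Qed.

Lemma ideal_sum M (I : Type) (r : seq I) (P : pred I) (F : I -> B) :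
  is_ideal M -> (forall i, P i -> M (F i)) -> M (\sum_(i <- r | P i) F i).
Proof. by move=> [M0 MD _] MF; exact: big_ind. Qed.

Lemma ideal_mulr M c a : is_ideal M -> M a -> M (a * c).
Proof. by move=> [_ _ MM] Ma; rewrite mulrC; apply: MM. Qed.

Lemma span2_gen1 p q : span2 unit_ideal p q p.
Proof. by exists 1, 0; split=> //; ring. Qed.

Lemma span2_gen2 p q : span2 unit_ideal p q q.
Proof. by exists 0, 1; split=> //; ring. Qed.

Lemma span2_mul M p q a b : is_ideal M -> M a -> span2 unit_ideal p q b ->
  span2 M p q (a * b).
Proof.
move=> MI Ma [c [d [_ _ ->]]].
by exists (a * c), (a * d); split; [apply: ideal_mulr|apply: ideal_mulr|ring].
Qed.

Lemma span2_mono M N p q a : (forall c, M c -> N c) -> span2 M p q a -> span2 N p q a.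
Proof. by move=> MN [c [d [Mc Md ->]]]; exists c, d; split=> //; apply: MN. Qed.

End TwoGenerators.

(** * The square of the ideal of the diagonal *)

Section DiagonalSquare.
Variables (R : comNzRingType) (A : comAlgType R) (p q : A).
Implicit Types (f g a : A) (w : tensor A A).

Definition diag_gen : tensor A A -> Prop := span2 (@unit_ideal _) (delta p) (delta q).
Definition diag_gen2 : tensor A A -> Prop := span2 diag_gen (delta p) (delta q).
Definition diag_squares : tensor A A -> Prop :=
  span2 (@unit_ideal _) (delta p ^+ 2) (delta q ^+ 2).

Lemma diag_gen_ideal : is_ideal diag_gen.
Proof. exact/span2_ideal/unit_ideal_ideal. Qed.

Lemma diag_gen2_ideal : is_ideal diag_gen2.
Proof. exact/span2_ideal/diag_gen_ideal. Qed.

Lemma diag_squares_ideal : is_ideal diag_squares.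
Proof. exact/span2_ideal/unit_ideal_ideal. Qed.

Lemma diag_gen2_mul v w : diag_gen v -> diag_gen w -> diag_gen2 (v * w).
Proof. exact/span2_mul/diag_gen_ideal. Qed.

(** The elements [f] with [delta f] in [diag_gen] form a subalgebra closed under
    inverses: two elements generate the diagonal ideal of the localization of the
    algebra that they generate. *)
Lemma delta_alg_in (c : R) : diag_gen (delta (c%:A : A)).
Proof. by rewrite delta_alg; have [] := diag_gen_ideal. Qed.

Lemma delta_add_in f g : diag_gen (delta f) -> diag_gen (delta g) ->
  diag_gen (delta (f + g)).
Proof. by rewrite deltaD; have [_ ID _] := diag_gen_ideal; apply: ID. Qed.

Lemma delta_mul_in f g : diag_gen (delta f) -> diag_gen (delta g) ->
  diag_gen (delta (f * g)).
Proof.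
move=> hf hg; rewrite deltaM; have [_ ID IM] := diag_gen_ideal.
by apply: (ID); [apply: ID|]; apply: IM.
Qed.

Lemma delta_div_in f g h : f * g = 1 -> diag_gen (delta f) -> diag_gen (delta h) ->
  diag_gen (delta (g * h)).
Proof.
move=> fg hf hh; apply: delta_mul_in => //; have [_ ID IM] := diag_gen_ideal.
have: delta (f * g) = 0 by rewrite fg -(delta_alg A 1) scale1r.
have fg2 : (1 \ox f) * (1 \ox g) = 1 :> tensor A A by rewrite -tensrM fg tens11.
rewrite deltaM => /(congr1 ( *%R (1 \ox g))).
rewrite mulr0 => e.
rewrite (_ : delta g = - ((1 \ox g) * ((1 \ox g) + delta g)) * delta f); first exact: IM.
by apply/eqP; rewrite -subr_eq0 -e -{1}[delta g]mul1r -fg2; apply/eqP; ring.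
Qed.

(** The hypotheses say that [delta p], [delta q] generate the ideal of the diagonal
    and that [dp] generates the differentials.  The second one is what makes the
    mixed product [delta p * delta q] redundant: multiply the congruence
    [delta q = (1 \ox a) * delta p] modulo squares by [delta p]. *)
Section Generated.
Hypothesis delta_gen : forall f, diag_gen (delta f).
Variable a : A.
Hypothesis dq_dp : diag_gen2 (delta q - (1 \ox a) * delta p).

Lemma mixed_in_squares : diag_squares (delta p * delta q).
Proof.
have [c [d [[c1 [c2 [_ _ ->]]] [d1 [d2 [_ _ ->]]] e]]] := dq_dp.
exists ((1 \ox a) + c1 * delta p + c2 * delta q + d1 * delta q), (d2 * delta p).
by split=> //; rewrite -[in LHS](subrK ((1 \ox a) * delta p) (delta q)) e; ring.
Qed.

Lemma diag_gen2_squares w : diag_gen2 w -> diag_squares w.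
Proof.
move=> [c [d [[c1 [c2 [_ _ ->]]] [d1 [d2 [_ _ ->]]] ->]]].
have [_ ID IM] := diag_squares_ideal.
rewrite (_ : _ + _ = c1 * delta p ^+ 2 + d2 * delta q ^+ 2
    + (c2 + d1) * (delta p * delta q)); last by ring.
by apply: ID; [exists c1, d2|exact/IM/mixed_in_squares].
Qed.

Lemma in_diag_gen w : in_diag w -> diag_gen w.
Proof.
move=> w0; have [l ->] := diag_decomposition w; rewrite w0 tens0r add0r.
apply: ideal_sum; first exact: diag_gen_ideal.
by move=> g _; have [_ _ IM] := diag_gen_ideal; apply: IM.
Qed.

Lemma in_diag_mul v w : in_diag v -> in_diag w -> diag_squares (v * w).
Proof.
by move=> /in_diag_gen hv /in_diag_gen hw; apply/diag_gen2_squares/diag_gen2_mul.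
Qed.

Lemma delta_congr f : exists c, diag_squares (delta f - (1 \ox c) * delta p).
Proof.
have [b [d [_ _ e]]] := delta_gen f.
exists (tens_prod b + tens_prod d * a).
have [_ ID IM] := diag_squares_ideal.
have diagB u : in_diag (u - 1 \ox tens_prod u).
  by rewrite /in_diag tens_prodB tens_prodE mul1r subrr.
have hq := diag_gen2_squares dq_dp.
rewrite (_ : _ - _ = (b - 1 \ox tens_prod b) * delta p +
  (d - 1 \ox tens_prod d) * delta q +
   (1 \ox tens_prod d) * (delta q - (1 \ox a) * delta p)).
  by do 2?apply: (ID); [apply: in_diag_mul=> //; apply: delta_diag..|exact: IM].
by rewrite e tensDr tensrM; ring.
Qed.

End Generated.

End DiagonalSquare.
(** * Homogeneous forms in two elements *)

Section Forms.
Variables (B : comPzRingType) (X Y : B).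
Implicit Types (m n k i j : nat) (a b : B).

Lemma subXX_left n : X ^+ n - Y ^+ n = (X - Y) * \sum_(i < n) X ^+ i * Y ^+ (n.-1 - i).
Proof.
rewrite -opprB subrXX -mulNr opprB; congr (_ * _).
by apply: eq_bigr => i _; rewrite mulrC.
Qed.

(** The coefficients of the quotient of the form
    [m (X^n - Y^n) - n Y^(n-m) (X^m - Y^m)] by [(X - Y)^2], shifted by one so that
    they vanish at both ends [0] and [n]. *)
Definition tent m n j : nat := if (j <= m)%N then (j * (n - m))%N else (m * (n - j))%N.

Lemma tent_gt0 m n j : (0 < m)%N -> (m < n)%N -> (0 < j)%N -> (j < n)%N ->
  (0 < tent m n j)%N.
Proof. by move=> *; rewrite /tent; case: ifP => _; rewrite muln_gt0 ?subn_gt0; apply/andP. Qed.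

Lemma tent_diff m n j : (m < n)%N -> (j < n)%N ->
  (tent m n j)%:R - (tent m n j.+1)%:R = m%:R - (if (j < m)%N then n%:R else 0) :> B.
Proof.
move=> lmn ljn; rewrite /tent; case: (ltngtP j m) => [ljm|lmj|->].
- by rewrite !natrM natrB ?(ltnW lmn) // -addn1 natrD; ring.
- by rewrite !natrM !natrB // ?(ltnW ljn) // -[j.+1]addn1 natrD; ring.
- by rewrite !natrM !natrB // ?(ltnW lmn) // -[m.+1]addn1 natrD; ring.
Qed.

(** The form vanishes doubly on [X = Y], and its quotient by [(X - Y)^2] has positive
    coefficients; dividing by [X - Y] a second time is a summation by parts. *)
Lemma double_quotient m n : (0 < m)%N -> (m < n)%N ->
  m%:R * (X ^+ n - Y ^+ n) - n%:R * Y ^+ (n - m) * (X ^+ m - Y ^+ m) =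
  \sum_(i < n.-1) X ^+ i * Y ^+ (n - 2 - i) * ((tent m n i.+1)%:R * (X - Y) ^+ 2).
Proof.
case: n => // n m_gt0 lmn.
pose c j : B := (tent m n.+1 j)%:R; pose a j := X ^+ j * Y ^+ (n - j).
have c0 : c 0 = 0 by rewrite /c /tent.
have cn : c n.+1 = 0 by rewrite /c /tent leqNgt lmn /= subnn muln0.
have -> : n.+1%:R * Y ^+ (n.+1 - m) * (X ^+ m - Y ^+ m) =
    (X - Y) * \sum_(i < n.+1) (if (i < m)%N then n.+1%:R else 0) * a i.
  rewrite subXX_left -mulrA !(mulrCA _ (X - Y)); congr (_ * _).
  under [RHS]eq_bigr do rewrite mulrC -mulrb mulrnAr -mulrnAl mulrC mulrb.
  rewrite -mulr_sumr -big_mkcond -(big_ord_widen _ a) 1?ltnW //=; congr (_ * _).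
  rewrite mulr_sumr; apply: eq_bigr => i _; rewrite mulrCA -exprD; congr (_ * _ ^+ _).
  by move: (ltn_ord i) lmn; lia.
rewrite subXX_left mulrCA -mulrBr mulr_sumr -sumrB.
under eq_bigr => i _ do rewrite -mulrBl -tent_diff // mulrBl.
rewrite sumrB big_ord_recl big_ord_recr /= -/(c _) -/(c _) c0 cn !mul0r add0r addr0.
rewrite -sumrB mulr_sumr; apply: eq_bigr => i _.
have -> : (n.+1 - 2 - i)%N = (n - i.+1)%N by move: (ltn_ord i); lia.
rewrite -/(c _) /a (_ : (n - i = (n - i.+1).+1)%N); last by move: (ltn_ord i); lia.
rewrite !exprS; ring.
Qed.

(** [M] times the [k]-th power of the ideal generated by [X] and [Y], presented by its
    homogeneous generators, since the theorem asks for one coefficient per monomial. *)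
Definition form_in (M : B -> Prop) k a :=
  exists2 c : nat -> B, forall i, M (c i) &
    a = \sum_(i < k.+1) X ^+ i * Y ^+ (k - i) * c i.

Section FormIdeal.
Variables (J V M : B -> Prop) (k : nat).
Hypotheses (M_ideal : is_ideal M) (J_ideal : is_ideal J).
Hypothesis VJ_M : forall a b, V a -> J b -> M (a * b).
Hypotheses (VX : V X) (VY : V Y) (JXY : J ((X - Y) ^+ 2)).

Lemma form_in_ideal : is_ideal (form_in M k).
Proof.
have [M0 MD MM] := M_ideal; split=> [|_ _ [c Mc ->] [d Md ->]|e _ [c Mc ->]].
- by exists (fun=> 0) => //; rewrite big1 // => i _; rewrite mulr0.
- exists (fun i => c i + d i) => [i|]; first exact: MD.
  by rewrite -big_split; apply: eq_bigr => i _; rewrite mulrDr.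
- exists (fun i => e * c i) => [i|]; first exact: MM.
  by rewrite mulr_sumr; apply: eq_bigr => i _; rewrite mulrCA.
Qed.

Lemma monomial_form i j a : (i + j = k)%N -> M a -> form_in M k (X ^+ i * Y ^+ j * a).
Proof.
have [M0 _ _] := M_ideal.
move=> ijk Ma; exists (fun l => if l == i then a else 0) => [l|]; first by case: ifP.
have lik : (i < k.+1)%N by lia.
rewrite (bigD1 (Ordinal lik)) //= eqxx big1 ?addr0 => [|l].
  by congr (_ * _ ^+ _ * _); lia.
by rewrite -val_eqE /= => /negbTE ->; rewrite mulr0.
Qed.

Lemma monomial_form_succ i j a : (i + j = k.+1)%N -> J a ->
  form_in M k (X ^+ i * Y ^+ j * a).
Proof.
case: i => [|i] ijk Ja.
  case: j ijk => // j jk; rewrite exprSr mulrA -mulrA.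
  by apply: monomial_form; [lia|apply: VJ_M].
rewrite (_ : _ * a = X ^+ i * Y ^+ j * (X * a)); last by rewrite exprS; ring.
by apply: monomial_form; [lia|apply: VJ_M].
Qed.

Lemma monomial_diff i j e : (i + j + e = k.+2)%N ->
  form_in M k ((X ^+ (i + e) * Y ^+ j - X ^+ i * Y ^+ (j + e)) * (X - Y)).
Proof.
move=> ije.
have -> : (X ^+ (i + e) * Y ^+ j - X ^+ i * Y ^+ (j + e)) * (X - Y) =
    \sum_(l < e) X ^+ (i + l) * Y ^+ (j + (e.-1 - l)) * (X - Y) ^+ 2.
  transitivity (X ^+ i * Y ^+ j * (X ^+ e - Y ^+ e) * (X - Y)); first by rewrite !exprD; ring.
  rewrite subXX_left -mulr_suml; set S := \sum_(l < e) _.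
  rewrite (_ : \sum_(l < e) _ = X ^+ i * Y ^+ j * S); first by ring.
  by rewrite mulr_sumr; apply: eq_bigr => l _; rewrite !exprD; ring.
apply: ideal_sum; first exact: form_in_ideal.
by move=> l _; apply: monomial_form_succ => //; move: (ltn_ord l); lia.
Qed.

(** The difference is [X - Y] times a sum of monomials of degree [k + 1].  Together with
    the factor [X - Y] of the statement this puts [(X - Y)^2] in [J], and one factor [X]
    or [Y] of each monomial can be spent to pass from [J] to [M]. *)
Lemma monomial_congr i j i' j' : (i + j = k.+2)%N -> (i' + j' = k.+2)%N ->
  form_in M k ((X ^+ i * Y ^+ j - X ^+ i' * Y ^+ j') * (X - Y)).
Proof.
move=> ij ij'; case: (leqP i i') => [lii'|/ltnW li'i].
  have -> : i' = (i + (i' - i))%N by lia.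
  have -> : j = (j' + (i' - i))%N by lia.
  rewrite -opprB mulNr; apply: ideal_opp; first exact: form_in_ideal.
  by apply: monomial_diff; lia.
have -> : i = (i' + (i - i'))%N by lia.
have -> : j' = (j + (i - i'))%N by lia.
by apply: monomial_diff; lia.
Qed.

Lemma form_in_sum_monomials (I : Type) (r : seq I) (P : pred I) (F : I -> B) :
  (forall x, P x -> form_in M k (F x * (X - Y))) ->
  form_in M k ((\sum_(x <- r | P x) F x) * (X - Y)).
Proof.
by move=> h; rewrite mulr_suml; apply: ideal_sum => //; apply: form_in_ideal.
Qed.

(** With [X = t \ox 1], [Y = 1 \ox t] this is the expansion of the tangent tensor of
    the pair [(t^m a, t^n b)] with the factor [Y^(m-1) dt] removed: [a1], [b1] are the
    derivatives of [a], [b] with respect to [t], and [a1 (X - Y) + ra],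
    [b1 (X - Y) + rb] are [delta a], [delta b].  The terms with [a b] make up the form of
    [double_quotient].  All others have degree greater than [n - 2] after division by
    [(X - Y)^2], and so contribute only coefficients in [M]. *)
Lemma tangent_form m n a a1 b b1 ra rb :
  (0 < m)%N -> (m < n)%N -> n = k.+2 -> J ra -> J rb ->
  exists2 c : nat -> B, forall i, M (c i) &
  (m%:R * a + Y * a1) * (X ^+ n * (b + (b1 * (X - Y) + rb)) - Y ^+ n * b) -
  Y ^+ (n - m) * (n%:R * b + Y * b1) * (X ^+ m * (a + (a1 * (X - Y) + ra)) - Y ^+ m * a)
  = \sum_(i < n.-1) X ^+ i * Y ^+ (n - 2 - i) *
      ((tent m n i.+1)%:R * (a * b) * (X - Y) ^+ 2 + c i).
Proof.
move=> m_gt0 lmn nk Jra Jrb.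
have [_ FD FM] := form_in_ideal; have [_ _ JM] := J_ideal.
pose Q1 := \sum_(i < n) (X ^+ i * Y ^+ (n - i) - X ^+ m * Y ^+ (n - m)).
pose Q2 := \sum_(i < m) (X ^+ n * Y ^+ 0 - X ^+ i * Y ^+ (n - i)).
pose Q3 := X ^+ n * Y ^+ 0 - X ^+ m * Y ^+ (n - m).
have eQ1 : Q1 * (X - Y) =
    Y * (X ^+ n - Y ^+ n) - n%:R * Y ^+ (n - m) * X ^+ m * (X - Y).
  rewrite /Q1 sumrB sumr_const card_ord -mulr_natl subXX_left.
  rewrite (_ : \sum_(i < n) X ^+ i * Y ^+ (n - i) =
      Y * \sum_(i < n) X ^+ i * Y ^+ (n.-1 - i)); first by ring.
  rewrite mulr_sumr; apply: eq_bigr => i _; rewrite mulrCA -exprS.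
  by congr (_ * _ ^+ _); move: (ltn_ord i); lia.
have eQ2 : Q2 * (X - Y) =
    m%:R * X ^+ n * (X - Y) - Y ^+ (n - m) * Y * (X ^+ m - Y ^+ m).
  rewrite /Q2 sumrB sumr_const card_ord -mulr_natl expr0 subXX_left.
  rewrite (_ : \sum_(i < m) X ^+ i * Y ^+ (n - i) =
      Y ^+ (n - m) * Y * \sum_(i < m) X ^+ i * Y ^+ (m.-1 - i)); first by ring.
  rewrite mulr_sumr; apply: eq_bigr => i _; rewrite mulrCA -exprSr -exprD.
  by congr (_ * _ ^+ _); move: (ltn_ord i); lia.
have [c Mc ec] : form_in M k
    (a1 * b * (Q1 * (X - Y)) + a * b1 * (Q2 * (X - Y)) + a1 * b1 * Y * (Q3 * (X - Y))
     + (m%:R * a + Y * a1) * (X ^+ n.-1 * Y ^+ 0 * (X * rb))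
     - (n%:R * b + Y * b1) * (X ^+ m.-1 * Y ^+ (n - m) * (X * ra))).
  apply: ideal_sub; first exact: form_in_ideal.
    do 3?apply: (FD); apply: FM.
    - by apply: form_in_sum_monomials => i _; apply: monomial_congr;
        move: (ltn_ord i); lia.
    - by apply: form_in_sum_monomials => i _; apply: monomial_congr;
        move: (ltn_ord i); lia.
    - by apply: monomial_congr; lia.
    - by apply: monomial_form_succ; [lia|apply: JM].
  by apply: FM; apply: monomial_form_succ; [lia|apply: JM].
exists c => //.
under eq_bigr do rewrite mulrDr; rewrite big_split /=.
rewrite (_ : \sum_(i < n.-1) _ = a * b * \sum_(i < n.-1)
    X ^+ i * Y ^+ (n - 2 - i) * ((tent m n i.+1)%:R * (X - Y) ^+ 2)); last first.
  by rewrite mulr_sumr; apply: eq_bigr => i _; ring.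
rewrite -double_quotient //.
have -> : \sum_(i < n.-1) X ^+ i * Y ^+ (n - 2 - i) * c i =
   \sum_(i < k.+1) X ^+ i * Y ^+ (k - i) * c i by rewrite nk !subSS subn0.
rewrite -ec eQ1 eQ2 /Q3.
have -> : X ^+ m.-1 * Y ^+ (n - m) * (X * ra) = X ^+ m * Y ^+ (n - m) * ra.
  by case: (m) m_gt0 => // m' _; rewrite /= exprS; ring.
have -> : X ^+ n.-1 * Y ^+ 0 * (X * rb) = X ^+ n * rb.
  by rewrite nk /= !exprS; ring.
have -> : Y ^+ n = Y ^+ (n - m) * Y ^+ m by rewrite -exprD subnK // ltnW.
by ring.
Qed.

End FormIdeal.

End Forms.
(** * The tangent tensor of a pair in normal form *)

Section NormalForm.
Variables (R : realFieldType) (A : comAlgType R) (p q : A).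
Variables (ev : {rmorphism A -> R}) (ev2 : {rmorphism tensor A A -> R}) (D : A -> A).
Hypothesis ev_alg : forall c : R, ev c%:A = c.
Hypothesis ev2E : forall f g, ev2 (f \ox g) = ev f * ev g.
Hypotheses (D_mul : forall f g, D (f * g) = f * D g + g * D f).
Local Notation J := (diag_squares p q).
Hypothesis delta_D : forall f, J (delta f - (1 \ox D f) * delta p).

(** The product of the ideal of the point with the square of the diagonal ideal. *)
Let M : tensor A A -> Prop :=
  span2 (fun w => ev2 w = 0) (delta p ^+ 2) (delta q ^+ 2).

Lemma ev2_ideal : is_ideal (fun w => ev2 w = 0).
Proof.
split=> [|v w v0 w0|v w w0]; first exact: rmorph0.
  by rewrite rmorphD v0 w0 addr0.
by rewrite rmorphM w0 mulr0.
Qed.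

Lemma point_squares_ideal : is_ideal M.
Proof. exact/span2_ideal/ev2_ideal. Qed.

Lemma point_mul_squares v w : ev2 v = 0 -> J w -> M (v * w).
Proof. exact/span2_mul/ev2_ideal. Qed.

Lemma ev2_delta f : ev2 (delta f) = 0.
Proof. by rewrite rmorphB !ev2E rmorph1 mulr1 mul1r subrr. Qed.

Lemma delta_sqr_congr f : M (delta f ^+ 2 - (1 \ox D f) ^+ 2 * delta p ^+ 2).
Proof.
set r := delta f - (1 \ox D f) * delta p; have Jr : J r := delta_D f.
rewrite (_ : _ - _ = (delta f + (1 \ox D f) * delta p) * r); last by rewrite /r; ring.
by apply: point_mul_squares; rewrite // rmorphD rmorphM !ev2_delta mulr0 addr0.
Qed.

(** Both coefficients can be made positive at the point by adding a small multiple of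
    the relation which expresses [delta q ^+ 2] through [delta p ^+ 2] modulo [M]. *)
Lemma positive_squares u v w : 0 < ev2 u -> ev2 v = 0 ->
  w = u * delta p ^+ 2 + v * delta q ^+ 2 ->
  exists a b, [/\ 0 < ev2 a, 0 < ev2 b & w = a * delta p ^+ 2 + b * delta q ^+ 2].
Proof.
move=> u_gt0 v0 ->; have [c [d [c0 d0 e]]] := delta_sqr_congr q.
pose k := ev (D q) ^+ 2; pose eps := ev2 u / (2 * (1 + k)).
have k_ge0 : 0 <= k by exact: sqr_ge0.
have eps_gt0 : 0 < eps by rewrite divr_gt0 // mulr_gt0 //; lra.
pose E : tensor A A := eps%:A \ox 1.
have evE : ev2 E = eps by rewrite ev2E ev_alg rmorph1 mulr1.
exists (u - E * ((1 \ox D q) ^+ 2 + c)), (v + E * (1 - d)); split.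
- rewrite rmorphB rmorphM rmorphD c0 rmorphXn evE ev2E rmorph1 mul1r addr0 -/k.
  have : eps * (2 * (1 + k)) = ev2 u by rewrite /eps divfK //; apply/eqP; lra.
  have : 0 <= eps * k by rewrite mulr_ge0 // ltW.
  by nra.
- by rewrite rmorphD rmorphM rmorphB rmorph1 v0 d0 evE subr0 mulr1 add0r.
- move/eqP: e; rewrite -subr_eq0 => /eqP e.
  by rewrite -[LHS]addr0 -(mulr0 E) -e; ring.
Qed.

Variables (t a b : A).
Hypotheses (evt : ev t = 0) (Dt_unit : exists w, D t * w = 1).

Lemma D_1 : D 1 = 0.
Proof. by apply: (addrI (D 1)); rewrite addr0 -[in RHS](mul1r 1) D_mul !mul1r. Qed.

Lemma D_exp f k : D (f ^+ k) = k%:R * f ^+ k.-1 * D f.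
Proof.
elim: k => [|[|k] IH]; first by rewrite expr0 D_1 !mul0r.
  by rewrite expr1 expr0 !mul1r.
by rewrite exprS D_mul IH /= [k.+2%:R]mulrS exprS; ring.
Qed.

Lemma tensr_nat k : 1 \ox (k%:R : A) = k%:R :> tensor A A.
Proof. by elim: k => [|k IH]; rewrite ?tens0r // !mulrS tensDr IH tens11. Qed.

Lemma tens_left f : f \ox (1 : A) = 1 \ox f + delta f.
Proof. by rewrite /delta; ring. Qed.

Definition tangent_pair (x y : A) : tensor A A :=
  (1 \ox D x) * delta y - (1 \ox D y) * delta x.

(** The common factors [t^(m-1)] and [D t] of the two derivatives come from the right
    factor of the tensor product; what they leave is the form of [tangent_form], and
    [delta t ^+ 2] is [(1 \ox D t)^2 * delta p ^+ 2] up to terms with coefficients that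
    vanish at the point. *)
Lemma tangent_normal_form m n : (0 < m)%N -> (m < n)%N ->
  exists u v : nat -> tensor A A,
  [/\ forall i, ev2 (u i) = (tent m n i.+1)%:R * (ev a * ev b * ev (D t) ^+ 3),
     forall i, ev2 (v i) = 0 &
     tangent_pair (t ^+ m * a) (t ^+ n * b) =
     (1 \ox t ^+ m.-1) * \sum_(i < n.-1) (t ^+ i \ox t ^+ (n - 2 - i)) *
        (u i * delta p ^+ 2 + v i * delta q ^+ 2)].
Proof.
move=> m_gt0 lmn; have [w tw] := Dt_unit.
have [_ JD JM] := diag_squares_ideal p q.
have delta_t f : J (delta f - (1 \ox (w * D f)) * delta t).
  rewrite (_ : _ - _ = delta f - (1 \ox D f) * delta p
     - (1 \ox (w * D f)) * (delta t - (1 \ox D t) * delta p)).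
    by apply: ideal_sub; [exact: diag_squares_ideal|exact: delta_D|exact: JM].
  have -> : 1 \ox D f = (1 \ox (w * D f)) * (1 \ox D t) :> tensor A A.
    by rewrite -tensrM mulrAC [w * _]mulrC tw mul1r.
  by ring.
pose X : tensor A A := t \ox 1; pose Y : tensor A A := 1 \ox t.
have XY : X - Y = delta t by [].
have Dxm c k : (0 < k)%N ->
    D (t ^+ k * c) = t ^+ k.-1 * D t * (k%:R * c + t * (w * D c)).
  case: k => // k _; rewrite D_mul D_exp /= exprS -[in LHS](mul1r (D c)) -tw; ring.
have dX c k : delta (t ^+ k * c) =
    X ^+ k * (1 \ox c + ((1 \ox (w * D c)) * (X - Y) +
      (delta c - (1 \ox (w * D c)) * delta t))) - Y ^+ k * (1 \ox c).
  transitivity (X ^+ k * (1 \ox c + delta c) - Y ^+ k * (1 \ox c)).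
    by rewrite -tens_left {1}/delta /X /Y !tensXn !expr1n !tensM !mul1r.
  by rewrite XY; ring.
have M_J v : M v -> J v by apply: span2_mono.
have p2_J : J (delta p ^+ 2) by exact: span2_gen1.
have JXY : J ((X - Y) ^+ 2).
  rewrite XY -[_ ^+ 2](subrK ((1 \ox D t) ^+ 2 * delta p ^+ 2)).
  by apply: JD; [exact/M_J/delta_sqr_congr|exact: JM].
have X0 : ev2 X = 0 by rewrite ev2E evt mul0r.
have Y0 : ev2 Y = 0 by rewrite ev2E evt mulr0.
have nk : n = n.-2.+2 by lia.
have [r Mr er] := @tangent_form _ X Y J (fun w => ev2 w = 0) M n.-2
  point_squares_ideal (diag_squares_ideal p q) point_mul_squares X0 Y0 JXY m n
  (1 \ox a) (1 \ox (w * D a)) (1 \ox b) (1 \ox (w * D b)) _ _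
  m_gt0 lmn nk (delta_t a) (delta_t b).
have [c [d [c0 d0 et]]] := delta_sqr_congr t.
have /choice[rc hrc] i : exists cd : tensor A A * tensor A A,
    [/\ ev2 cd.1 = 0, ev2 cd.2 = 0 & r i = cd.1 * delta p ^+ 2 + cd.2 * delta q ^+ 2].
  by have [e [f [e0 f0 ->]]] := Mr i; exists (e, f).
pose g i : tensor A A := (tent m n i.+1)%:R * ((1 \ox a) * (1 \ox b)).
exists (fun i => (1 \ox D t) * (g i * ((1 \ox D t) ^+ 2 + c) + (rc i).1)).
exists (fun i => (1 \ox D t) * (g i * d + (rc i).2)); split=> [i|i|].
- have [h1 _ _] := hrc i; rewrite !(rmorphM, rmorphD, rmorphXn) /= h1 c0 !ev2E.
  by rewrite rmorph_nat rmorph1; ring.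
- have [_ h2 _] := hrc i; rewrite !(rmorphM, rmorphD) /= h2 d0 mulr0 addr0.
  by rewrite mulr0.
have -> : tangent_pair (t ^+ m * a) (t ^+ n * b) =
    (1 \ox t ^+ m.-1) * ((1 \ox D t) * \sum_(i < n.-1) X ^+ i * Y ^+ (n - 2 - i) *
        (g i * (X - Y) ^+ 2 + r i)).
  rewrite -er /tangent_pair !dX !Dxm ?(ltn_trans m_gt0 lmn) //.
  have -> : n.-1 = (m.-1 + (n - m))%N by lia.
  rewrite exprD !tensrM !tensDr !tensrM !tensr_nat -/Y.
  have -> : 1 \ox t ^+ (n - m) = Y ^+ (n - m) by rewrite /Y tensXn expr1n.
  ring.
congr (_ * _); rewrite mulr_sumr; apply: eq_bigr => i _.
have [_ _ ->] := hrc i.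
have -> : X ^+ i * Y ^+ (n - 2 - i) = t ^+ i \ox t ^+ (n - 2 - i).
  by rewrite /X /Y !tensXn !expr1n tensM mulr1 mul1r.
rewrite XY -[_ ^+ 2](subrK ((1 \ox D t) ^+ 2 * delta p ^+ 2)) et; ring.
Qed.

(** All leading coefficients have the sign of one and the same number, the value at the
    point of [rho * a * b * (D t)^3]. *)
Lemma signed_normal_form m n (rho : tensor A A) :
  (0 < m)%N -> (m < n)%N -> ev2 rho != 0 -> ev a != 0 -> ev b != 0 ->
  exists (sgn : bool) (alpha beta : 'I_n.-1 -> tensor A A),
    (forall i, 0 < ev2 (alpha i) /\ 0 < ev2 (beta i)) /\
    (-1) ^+ sgn * (rho * tangent_pair (t ^+ m * a) (t ^+ n * b)) =
      (1 \ox t ^+ m.-1) * \sum_(i < n.-1) (t ^+ i \ox t ^+ (n - 2 - i)) *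
        (alpha i * delta p ^+ 2 + beta i * delta q ^+ 2).
Proof.
move=> m_gt0 lmn rho0 a0 b0; have [u [v [evu evv ->]]] := tangent_normal_form m_gt0 lmn.
have Dt0 : ev (D t) != 0.
  have [w tw] := Dt_unit; apply/eqP => e; move: (congr1 ev tw).
  by rewrite rmorphM e mul0r rmorph1 => /esym/eqP; rewrite oner_eq0.
pose k := ev2 rho * (ev a * ev b * ev (D t) ^+ 3).
have k0 : k != 0 by rewrite !mulf_neq0 // expf_neq0.
pose e : tensor A A := (-1) ^+ (k < 0)%R * rho.
have /choice[c hc] (i : 'I_n.-1) : exists cd : tensor A A * tensor A A,
    [/\ 0 < ev2 cd.1, 0 < ev2 cd.2 & e * (u i * delta p ^+ 2 + v i * delta q ^+ 2) =
                                     cd.1 * delta p ^+ 2 + cd.2 * delta q ^+ 2].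
  have [|||f [g [f_gt0 g_gt0 eq]]] := @positive_squares (e * u i) (e * v i)
      (e * (u i * delta p ^+ 2 + v i * delta q ^+ 2)).
  - rewrite rmorphM evu /e rmorphM rmorphXn rmorphN1.
    rewrite (_ : _ * _ = (tent m n i.+1)%:R * ((-1) ^+ (k < 0)%R * k)).
      rewrite -normrEsign mulr_gt0 ?normr_gt0 // ltr0n tent_gt0 //.
      by move: (ltn_ord i); lia.
    by rewrite /k; ring.
  - by rewrite rmorphM evv mulr0.
  - by ring.
  by exists (f, g).
exists (k < 0)%R, (fun i => (c i).1), (fun i => (c i).2); split=> [i|].
  by have [] := hc i.
rewrite (mulrA _ rho) -/e mulrCA; congr (_ * _); rewrite mulr_sumr; apply: eq_bigr => i _.
by have [_ _ <-] := hc i; rewrite mulrCA.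
Qed.

End NormalForm.
(** * Polynomial expressions in two elements of an algebra *)

Lemma poly2_ind (R : nzRingType) (Q : {poly {poly R}} -> Prop) :
    (forall c, Q c%:P%:P) -> Q 'X%:P -> Q 'X ->
    (forall G H, Q G -> Q H -> Q (G + H)) -> (forall G H, Q G -> Q H -> Q (G * H)) ->
  forall G, Q G.
Proof.
move=> QC QX QY QD QM; elim/poly_ind => [|G c IH]; first exact: (QC 0).
apply: (QD); first exact: (QM).
by elim/poly_ind: c => [|g c IHg]; [exact: (QC 0)|rewrite polyCD polyCM; apply/QD/QC/QM].
Qed.

Section Biv.
Variables (R : comNzRingType) (A : comAlgType R) (p q : A).
Implicit Types G H : {poly {poly R}}.

(** [bieval] over an arbitrary commutative algebra, so that it applies to the local
    ring as well as to the function field. *)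
Definition biv : {poly {poly R}} -> A := horner_eval q \o map_poly (horner_alg p).
HB.instance Definition _ := GRing.RMorphism.on biv.

Lemma biv_inner (c : {poly R}) : biv c%:P = horner_alg p c.
Proof. by rewrite /biv /= map_polyC /horner_eval hornerC. Qed.

Lemma bivC (c : R) : biv c%:P%:P = c%:A.
Proof. by rewrite biv_inner horner_algC. Qed.

Lemma biv_innerX : biv 'X%:P = p.
Proof. by rewrite biv_inner horner_algX. Qed.

Lemma bivX : biv 'X = q.
Proof. by rewrite /biv /= map_polyX /horner_eval hornerX. Qed.

Lemma biv_XsubC (c : R) : biv ('X - c%:P%:P) = q - c%:A.
Proof. by rewrite /biv /= map_polyXsubC /horner_eval hornerXsubC /= horner_algC. Qed.

Lemma bivB G H : biv (G - H) = biv G - biv H.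
Proof. exact: rmorphB. Qed.

Lemma bivM G H : biv (G * H) = biv G * biv H.
Proof. exact: rmorphM. Qed.

Lemma bivZ (c : {poly R}) G : biv (c *: G) = biv c%:P * biv G.
Proof. by rewrite -mul_polyC rmorphM. Qed.

Lemma biv_diag_gen G : diag_gen p q (delta (biv G)).
Proof.
elim/poly2_ind: G => [c|||G H|G H].
- by rewrite bivC; apply: delta_alg_in.
- by rewrite biv_innerX; apply: span2_gen1.
- by rewrite bivX; apply: span2_gen2.
- by rewrite rmorphD; apply: delta_add_in.
- by rewrite rmorphM; apply: delta_mul_in.
Qed.

(** The chain rule: modulo products of two elements of [diag_gen], [delta] is a
    derivation, so its value at a polynomial expression is a combination of [delta p]
    and [delta q] whose second coefficient is the partial derivative. *)
Lemma biv_taylor G : exists a,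
  diag_gen2 p q (delta (biv G) - (1 \ox a) * delta p - (1 \ox biv G^`()) * delta q).
Proof.
have [I0 ID IM] := diag_gen2_ideal p q.
elim/poly2_ind: G => [c|||G H [a ha] [b hb]|G H [a ha] [b hb]].
- exists 0; rewrite bivC delta_alg derivC rmorph0 tens0r (_ : _ - _ = 0) //; ring.
- exists 1; rewrite biv_innerX derivC rmorph0 tens0r tens11 (_ : _ - _ = 0) //; ring.
- exists 0; rewrite bivX derivX rmorph1 tens0r tens11 (_ : _ - _ = 0) //; ring.
- exists (a + b); rewrite derivD !rmorphD deltaD !tensDr.
  by move: (ID _ _ ha hb); congr (diag_gen2 _ _ _); ring.
- exists (biv G * b + biv H * a); rewrite derivM rmorphD !rmorphM deltaM !tensDr !tensrM.
  have hGH := diag_gen2_mul (biv_diag_gen G) (biv_diag_gen H).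
  have hG := IM (1 \ox biv G) _ hb; have hH := IM (1 \ox biv H) _ ha.
  by move: (ID _ _ (ID _ _ hG hH) hGH); congr (diag_gen2 _ _ _); ring.
Qed.

End Biv.

Lemma biv_comp (R : comNzRingType) (A : comAlgType R) (p q : A)
  (G H : {poly {poly R}}) : biv p q (G \Po H) = biv p (biv p q H) G.
Proof.
elim/poly2_ind: G => [c|||G G' IH IH'|G G' IH IH'].
- by rewrite comp_polyC !bivC.
- by rewrite comp_polyC !biv_innerX.
- by rewrite comp_polyX bivX.
- by rewrite comp_polyD !rmorphD /= IH IH'.
- by rewrite comp_polyM !rmorphM /= IH IH'.
Qed.

Lemma biv_swapXY (R : comNzRingType) (A : comAlgType R) (p q : A)
  (G : {poly {poly R}}) : biv p q (swapXY G) = biv q p G.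
Proof.
elim/poly2_ind: G => [c|||G G' IH IH'|G G' IH IH'].
- by rewrite swapXY_polyC map_polyC !bivC.
- by rewrite swapXY_Y bivX biv_innerX.
- by rewrite swapXY_X biv_innerX bivX.
- by rewrite !rmorphD /= IH IH'.
- by rewrite !rmorphM /= IH IH'.
Qed.
(** * The local ring of a real point *)

Section LocalPoint.
Variables (R : realType) (K : fieldAlgType R) (x y : K) (xi : real_point x y).
Local Notation L := (local_ring xi).
Implicit Types f g : L.

Definition point_eval f : R := eval_at xi (val f).

Lemma point_evalB : {morph point_eval : f g / f - g}.
Proof.
move=> f g; apply/eqP; rewrite eq_sym subr_eq /point_eval -eval_atD ?local_valP //.
by rewrite -[_ + _]/(val (f - g + g)) subrK.
Qed.

Lemma point_eval1 : point_eval 1 = 1.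
Proof.
have := @eval_atE _ _ _ _ xi 1 1; rewrite !rmorph1 !divr1 => e.
by rewrite /point_eval rmorph1 e ?oner_neq0.
Qed.

Lemma point_evalM : {morph point_eval : f g / f * g}.
Proof. by move=> f g; rewrite /point_eval -eval_atM ?local_valP. Qed.

HB.instance Definition _ := GRing.isZmodMorphism.Build _ _ point_eval point_evalB.
HB.instance Definition _ := GRing.isMonoidMorphism.Build _ _ point_eval
  (point_eval1, point_evalM).

Lemma point_eval_alg (c : R) : point_eval c%:A = c.
Proof.
rewrite /point_eval -[val _]/(c *: val (1 : L)) eval_atZ ?local_valP //.
by rewrite -[eval_at _ _]/(point_eval 1) point_eval1 mulr1.
Qed.

Lemma local_unit f : point_eval f != 0 -> exists g, f * g = 1.
Proof.
rewrite /point_eval; have /local_atP[a [b [b0 e]]] := local_valP f.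
rewrite -[val f]/(local_val f) e eval_atE // mulf_eq0 negb_or => /andP[a0 _].
have h : val b / val a \in local_at xi by apply/local_atP; exists b, a.
exists (LocalRing h); apply: val_inj; rewrite rmorphM /= e mulrA divfK ?divff //.
  by apply: xi_neq0 a0.
by apply: xi_neq0 b0.
Qed.

Lemma local_neq0 f g : f != 0 -> g != 0 -> f * g != 0.
Proof. by rewrite -!(inj_eq val_inj) rmorphM mulf_eq0 => /negbTE -> /negbTE ->. Qed.

Lemma local_mulI f g h : f != 0 -> f * g = f * h -> g = h.
Proof.
move=> f0 /eqP; rewrite -subr_eq0 -mulrBr => /eqP e.
apply/eqP; rewrite -subr_eq0; apply: contraT => /(local_neq0 f0).
by rewrite e eqxx.
Qed.

Lemma eval_at2E f g : eval_at2 (f \ox g) = point_eval f * point_eval g.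
Proof. exact: (tens_liftE (@eval_at2_balanced _ _ _ _ xi)). Qed.

Lemma eval_at2B : {morph @eval_at2 _ _ _ _ xi : u w / u - w}.
Proof. exact: (tens_liftB (@eval_at2_balanced _ _ _ _ xi)). Qed.

Lemma eval_at2M : {morph @eval_at2 _ _ _ _ xi : u w / u * w}.
Proof.
apply: (tens_liftM (@eval_at2_balanced _ _ _ _ xi)) => a b a' b'.
by rewrite -!/(point_eval _) !rmorphM mulrACA.
Qed.

Lemma eval_at2_1 : eval_at2 (1 : tensor L L) = 1.
Proof. by rewrite -tens11 eval_at2E rmorph1 mulr1. Qed.

HB.instance Definition _ := GRing.isZmodMorphism.Build _ _ (@eval_at2 R K x y xi) eval_at2B.
HB.instance Definition _ := GRing.isMonoidMorphism.Build _ _ (@eval_at2 R K x y xi)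
  (eval_at2_1, eval_at2M).

Lemma common_denominator (s : seq K) : {subset s <= local_at xi} ->
  exists2 b : nring x y, xi b != 0 &
    forall z, z \in s -> val b * z \in integral_closure x y.
Proof.
elim: s => [|z s IH] hs.
  by exists 1; rewrite ?rmorph1 ?oner_neq0.
have [w ws|b b0 hb] := IH; first by apply: hs; rewrite inE ws orbT.
have /local_atP[a [c [c0 e]]] := hs z (mem_head _ _).
exists (b * c) => [|w]; first by rewrite rmorphM mulf_neq0.
rewrite inE rmorphM => /orP[/eqP ->|/hb h].
    by rewrite e -mulrA [val c * _]mulrC divfK ?(xi_neq0 c0) // rpredM ?nring_valP.
by rewrite /= -mulrA mulrCA rpredM ?nring_valP.
Qed.

(** If [c] is the leading coefficient of a polynomial of degree [d] with root [z], then
    [c * z] is a root of a monic polynomial, whose coefficients are multiples of the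
    original ones by powers of [c]. *)
Lemma lead_coef_mul_local (P : {poly K}) z : P != 0 -> root P z ->
  (forall i, P`_i \in local_at xi) -> lead_coef P * z \in local_at xi.
Proof.
move=> P0 Pz hP; have [s hs|b b0 hb] := @common_denominator P.
  by have [i _ <-] := (nthP 0 hs); apply: hP.
have hbP i : val b * P`_i \in integral_closure x y.
  have [lip|] := ltnP i (size P); first exact/hb/mem_nth.
  by move=> /(nth_default 0) ->; rewrite mulr0 rpred0.
case sP : (size P) => [|[|d]]; first by move: P0; rewrite -size_poly_eq0 sP.
  have /size_poly1P[c c0 e] : size P == 1%N by rewrite sP.
  by move: Pz c0; rewrite e rootC => /eqP -> ; rewrite eqxx.
(* [c] clears the denominators at the same time as it makes the polynomial monic. *)
pose c := val b * lead_coef P.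
pose Q := \poly_(i < d.+2) (if i == d.+1 then 1 else val b * P`_i * c ^+ (d - i)).
have sQ : size Q = d.+2 by rewrite size_poly_eq // eqxx oner_neq0.
have hcz : c * z \in integral_closure x y.
  apply/integral_closureP; apply: (@integral_root_monic _ _ _ _ Q).
  - by rewrite monicE lead_coefE sQ coef_poly ltnSn eqxx.
  - rewrite /root horner_poly big_ord_recr /= eqxx mul1r.
    have h : \sum_(i < d.+2) P`_i * z ^+ i = 0.
      by rewrite -sP -horner_coef; apply/eqP.
    rewrite big_ord_recr /= in h.
    move: (congr1 ( *%R (val b * c ^+ d)) h); rewrite mulr0 mulrDr mulr_sumr => e.
    apply/eqP; apply: etrans e; congr (_ + _).
      apply: eq_bigr => i _; rewrite (ltn_eqF (ltn_ord i)) /= [(c * z) ^+ i]exprMn.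
      have -> : c ^+ d = c ^+ (d - i) * c ^+ i by rewrite -exprD subnK // -ltnS.
      by ring.
    by rewrite [(c * z) ^+ _]exprMn [c ^+ d.+1]exprS {1}/c lead_coefE sP /=; ring.
  move=> _ /(nthP 0)[i _ <-]; apply/integral_closureP; rewrite coef_poly.
  case: ifP => _; last exact: rpred0.
  case: eqP => _; first exact: rpred1.
  by rewrite rpredM ?rpredX // /c lead_coefE.
apply/local_atP; exists (NRing hcz), b; split=> //.
by rewrite [RHS]mulrC /= /c -[_ * _ * z]mulrA mulKf // (xi_neq0 b0).
Qed.

End LocalPoint.
(** * The local ring is the valuation ring on algebraic elements *)

Section Valuation.
Variables (R : realType) (K : fieldAlgType R) (x y : K) (xi : real_point x y).
Variable (v : K -> int).
Hypothesis v_xi : valuation_centered xi v.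
Local Notation L := (local_ring xi).
Implicit Types (f g : L) (a b z : K).

Lemma local_valM f g : val (f * g) = val f * val g.
Proof. by []. Qed.

Lemma local_valD f g : val (f + g) = val f + val g.
Proof. by []. Qed.

Lemma local_valB f g : val (f - g) = val f - val g.
Proof. by []. Qed.

Lemma local_val_eq0 f : (val f == 0) = (f == 0).
Proof. exact: (inj_eq val_inj f 0). Qed.

Lemma valuation1 : v 1 = 0.
Proof. by apply: (addrI (v 1)); rewrite -(valuationM v_xi) ?oner_neq0 // mulr1 addr0. Qed.

Lemma valuationV a : a != 0 -> v a^-1 = - v a.
Proof.
move=> a0; apply/eqP; rewrite -addr_eq0 -(valuationM v_xi) ?invr_eq0 //.
by rewrite mulVf // valuation1.
Qed.

Lemma valuation_local_mul f g : f != 0 -> g != 0 -> v (val (f * g)) = v (val f) + v (val g).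
Proof. by rewrite -!local_val_eq0; apply: (valuationM v_xi). Qed.

Lemma local_exp_neq0 f k : f != 0 -> f ^+ k != 0.
Proof.
by move=> f0; elim: k => [|k IH]; [rewrite expr0 oner_neq0|rewrite exprS local_neq0].
Qed.

Lemma valuation_local_exp f k : f != 0 -> v (val (f ^+ k)) = v (val f) *+ k.
Proof.
move=> f0; elim: k => [|k IH]; first by rewrite valuation1.
by rewrite exprS valuation_local_mul ?local_exp_neq0 // IH mulrS.
Qed.

Lemma eval_at0 : eval_at xi 0 = 0.
Proof. exact: (rmorph0 (@point_eval R K x y xi)). Qed.

Lemma point_eval_neq0 f : point_eval f != 0 -> f != 0.
Proof. by apply: contraNneq => ->; rewrite rmorph0. Qed.

Lemma valuation_unit f : point_eval f != 0 -> v (val f) = 0.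
Proof.
move=> f0; have vf0 : val f != 0 by exact: point_eval_neq0 f0.
have := valuation_ge0 v_xi (local_valP f) vf0.
have := valuation_gt0 v_xi (local_valP f) vf0.
by rewrite (negbTE f0) => /negbT; rewrite -leNgt => h1 h2; apply/le_anti/andP.
Qed.

Lemma valuation_local_gt0 f : f != 0 -> point_eval f = 0 -> 0 < v (val f).
Proof.
by move=> f0 ef; rewrite (valuation_gt0 v_xi (local_valP f)) //; apply/eqP.
Qed.

Lemma valuation_nat f : f != 0 -> exists k : nat, v (val f) = k%:Z.
Proof.
rewrite -local_val_eq0 => f0; have h := valuation_ge0 v_xi (local_valP f) f0.
by exists `|v (val f)|%N; rewrite gez0_abs.
Qed.

(** The leading coefficient [l] of [P] is replaced, as long as it is not a unit, by
    adding the term [l * z], which again lies in the local ring, to the next coefficient;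
    the value of [z] being nonnegative, [l * z] is not a unit either, so that the
    polynomial of smaller degree has the same unit coefficient. *)
Lemma unit_coef_root_local d (P : {poly K}) z : (size P <= d)%N -> root P z ->
    (forall i, P`_i \in local_at xi) -> (exists i, eval_at xi P`_i != 0) ->
    z != 0 -> 0 <= v z ->
  z \in local_at xi.
Proof.
elim: d P => [|d IH] P sP Pz hP [i Pi] z0 vz.
  move: Pi; move: sP; rewrite leqn0 size_poly_eq0 => /eqP ->; rewrite coef0.
  by rewrite eval_at0 eqxx.
have P0 : P != 0.
  apply: contraNneq Pi => ->; rewrite coef0.
  by rewrite eval_at0 eqxx.
have lP : lead_coef P \in local_at xi by rewrite lead_coefE.
pose l : L := LocalRing lP; pose w : L := LocalRing (lead_coef_mul_local P0 Pz hP).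
have wE : val w = val l * z by [].
have l0 : l != 0 by rewrite -local_val_eq0 lead_coef_eq0.
have [el|/local_unit[g lg]] := eqVneq (point_eval l) 0; last first.
  have -> : z = val (g * w).
    by rewrite local_valM wE mulrA -local_valM [g * l]mulrC lg mul1r.
  exact: local_valP.
have ew : point_eval w = 0.
  apply/eqP; apply: contraT => /valuation_unit.
  rewrite wE (valuationM v_xi) // => e; move: (valuation_local_gt0 l0 el).
  by move: e vz; lia.
have [e1 sPd] : (1 < size P)%N /\ (size P).-1 = (size P).-2.+1.
  suff : (1 < size P)%N by split=> //; lia.
  rewrite ltnNge; apply/negP => /size1_polyC e.
  suff c0 : P`_0 = 0 by move: (P0); rewrite {1}e c0 polyC0 eqxx.
  by apply/eqP; move: (Pz); rewrite {1}e rootC.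
set k := (size P).-2 in sPd.
pose Q := P - (lead_coef P)%:P * 'X^(k.+1) + (val w)%:P * 'X^k.
have coefQ j : Q`_j = P`_j - (if j == k.+1 then val l else 0)
                       + (if j == k then val w else 0).
  by rewrite coefD coefB !coefCM !coefXn; do 2![case: eqP => _]; rewrite ?mulr1 ?mulr0.
have hQ j : exists2 u : L, Q`_j = val u &
    j != k.+1 -> point_eval u = eval_at xi P`_j.
  pose u : L := LocalRing (hP j) - (if j == k.+1 then l else 0)
                + (if j == k then w else 0).
  exists u => [|/negbTE jk].
    by rewrite coefQ /u local_valD local_valB; do 2![case: eqP => _].
  by rewrite /u jk subr0 rmorphD /=; case: ifP => _; rewrite ?ew ?rmorph0 addr0.
apply: (IH Q) => //.
- apply/leq_sizeP => j dj; rewrite coefQ.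
  move: (sP) (e1) (sPd); rewrite /k => {}sP {}e1 {}sPd.
  have jk : (j == (size P).-2) = false.
    by apply: gtn_eqF; lia.
  rewrite jk addr0; case: eqP => [->|jk1]; first by rewrite -sPd -lead_coefE subrr.
  have jP : (size P <= j)%N by lia.
  by rewrite (nth_default 0 jP) subr0.
- rewrite /root /Q hornerD hornerD hornerN !hornerM !hornerC !hornerXn (eqP Pz).
  by rewrite exprS wE; apply/eqP; rewrite /=; ring.
- by move=> j; have [u -> _] := hQ j; apply: local_valP.
exists i; have [u -> hu] := hQ i; rewrite -/(point_eval u) hu //.
apply: contraNneq Pi => ->; rewrite -sPd -lead_coefE -[lead_coef P]/(val l).
by apply/eqP.
Qed.

End Valuation.
(** * Resolution of the singularity by blowing up *)

Section PolyFacts.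
Variable R : realType.
Implicit Types G : {poly {poly R}}.

Lemma deriv_eq0_const G : G^`() = 0 -> exists c, G = c%:P.
Proof.
move=> dG; exists G`_0; apply: size1_polyC; apply/leq_sizeP => -[//|i] _.
apply/polyP => j; rewrite coef0; have := congr1 (fun H : {poly {poly R}} => H`_i`_j) dG.
by rewrite coef_deriv !coef0 coefMn => /eqP; rewrite mulrn_eq0 => /eqP.
Qed.

(** Dividing out powers of ['X - c] stops because the degree of the leading coefficient
    drops. *)
Lemma primitive_part_at (c : R) G : G != 0 ->
  exists j H, G = ('X - c%:P) ^+ j *: H /\ exists i, (H`_i).[c] != 0.
Proof.
have [k] := ubnP (size (lead_coef G)); elim: k G => // k IH G sG G0.
have [h|h] := pselect (exists i, (G`_i).[c] != 0).
  by exists 0, G; rewrite expr0 scale1r.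
pose H := \poly_(i < size G) (G`_i %/ ('X - c%:P)).
have eG : G = ('X - c%:P) *: H.
  apply/polyP => i; rewrite coefZ coef_poly; case: ltnP => [_|/(nth_default 0) ->].
    rewrite mulrC divpK // dvdp_XsubCl; apply/rootP.
    by apply/eqP; apply: contraT => hi; case: h; exists i.
  by rewrite mulr0.
have H0 : H != 0 by apply: contraNneq G0 => e; rewrite eG e scaler0.
have [|j [H' [eH hH]]] := IH H _ H0.
  move: sG; rewrite eG lead_coefZ size_mul ?polyXsubC_eq0 ?lead_coef_eq0 //.
  by rewrite size_XsubC.
by exists j.+1, H'; rewrite exprS -scalerA -eH.
Qed.

End PolyFacts.

Section Resolution.
Variables (R : realType) (K : fieldAlgType R) (x y : K) (xi : real_point x y).
Variable (v : K -> int).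
Hypothesis v_xi : valuation_centered xi v.
Local Notation L := (local_ring xi).
Implicit Types (f g p q : L) (G H : {poly {poly R}}).

Definition centered p : L := p - (point_eval p)%:A.

Lemma point_eval_centered p : point_eval (centered p) = 0.
Proof. by rewrite rmorphB /= point_eval_alg subrr. Qed.

Lemma point_eval_biv p q G :
  point_eval (biv p q G) = G.[(point_eval q)%:P].[point_eval p].
Proof.
elim/poly2_ind: G => [c|||G H IG IH|G H IG IH].
- by rewrite bivC point_eval_alg !hornerC.
- by rewrite biv_innerX hornerC hornerX.
- by rewrite bivX hornerX hornerC.
- by rewrite !rmorphD /= IG IH !hornerD.
- by rewrite !rmorphM /= IG IH !hornerM.
Qed.

Lemma val_biv p q G : val (biv p q G) = biv (val p) (val q) G.
Proof.
elim/poly2_ind: G => [c|||G H IG IH|G H IG IH].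
- by rewrite !bivC.
- by rewrite !biv_innerX.
- by rewrite !bivX.
- by rewrite rmorphD local_valD IG IH rmorphD.
- by rewrite rmorphM local_valM IG IH rmorphM.
Qed.

(** Up to a unit, a nonzero polynomial in [p] is a power of [p - p0]. *)
Lemma nonconstant_transcendental p (c : {poly R}) : centered p != 0 -> c != 0 ->
  horner_alg p c != 0.
Proof.
move=> p0 c0; have [k [d]] := multiplicity_XsubC c (point_eval p).
rewrite c0 /= => d0 ->; rewrite rmorphM rmorphXn rmorphB /= horner_algX horner_algC.
rewrite -/(centered p); apply: local_neq0; last exact: local_exp_neq0.
apply: point_eval_neq0; rewrite -(biv_inner p p) point_eval_biv hornerC.
exact: d0.
Qed.

(** In characteristic zero the derivative of a relation of positive degree is a nonzero
    polynomial of smaller degree; descend until it is not a relation any more. *)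
Lemma separable_relation p q G : centered p != 0 -> G != 0 -> biv p q G = 0 ->
  exists H, biv p q H = 0 /\ biv p q H^`() != 0.
Proof.
move=> p0; have [k] := ubnP (size G); elim: k G => // k IH G sG G0 pqG.
have [e|dG] := eqVneq (biv p q G^`()) 0; last by exists G.
have [/deriv_eq0_const[c eG]|dG0] := eqVneq G^`() 0.
  move: pqG G0; rewrite eG biv_inner polyC_eq0 => e' c0.
  by move: (nonconstant_transcendental p0 c0); rewrite e' eqxx.
by apply: (IH G^`()) => //; apply: leq_trans (lt_size_deriv G0) _.
Qed.

Definition generates p q := forall z : K, exists G H,
  biv p q H != 0 /\ z = val (biv p q G) / val (biv p q H).

Lemma generates_swap p q : generates p q -> generates q p.
Proof.
by move=> pq z; have [G [H h]] := pq z; exists (swapXY G), (swapXY H); rewrite !biv_swapXY.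
Qed.

Lemma relation_swap p q G : centered q != 0 -> G != 0 -> biv p q G = 0 ->
  exists H, biv q p H = 0 /\ biv q p H^`() != 0.
Proof.
move=> q0 G0 pqG; apply: (separable_relation (G := swapXY G)) => //.
  by rewrite swapXY_eq0.
by rewrite biv_swapXY.
Qed.

(** The line through the point with slope the outer indeterminate: the substitution
    which blows up the point. *)
Definition chart (c d : R) : {poly {poly R}} := d%:P%:P + ('X - c%:P)%:P * 'X.

Lemma biv_chart (A : comAlgType R) (a b : A) (c d : R) :
  biv a b (chart c d) = d%:A + (a - c%:A) * b.
Proof.
by rewrite rmorphD rmorphM /= bivC bivX biv_inner rmorphB /= horner_algX horner_algC.
Qed.

Lemma size_chart (c d : R) : size (chart c d) = 2%N.
Proof.
have sX : size (('X - c%:P)%:P * 'X : {poly {poly R}}) = 2%N.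
  by rewrite size_mulX ?polyC_eq0 ?polyXsubC_eq0 // size_polyC polyXsubC_eq0.
by rewrite /chart addrC size_polyDl ?sX // (leq_ltn_trans (size_polyC_leq1 _)).
Qed.

(** The slope [(q - q0) / (p - p0)] is a root of the primitive part of the transformed
    relation, which has a unit coefficient, and its value is nonnegative. *)
Lemma slope_local p q G : centered p != 0 -> centered q != 0 ->
    G != 0 -> biv p q G = 0 -> v (val (centered p)) <= v (val (centered q)) ->
  exists r, q = (point_eval q)%:A + centered p * r.
Proof.
move=> p0 q0 G0 pqG vpq.
pose z := val (centered q) / val (centered p).
have vp0 : val (centered p) != 0 by rewrite local_val_eq0.
have vq0 : val (centered q) != 0 by rewrite local_val_eq0.
suff hz : z \in local_at xi.
  exists (LocalRing hz); apply: val_inj; rewrite local_valD local_valM /=.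
  by rewrite mulrC divfK // -[LHS](subrK (val ((point_eval q)%:A : L))) addrC.
pose S := chart (point_eval p) (point_eval q).
have [|j [H [eH [i hi]]]] := @primitive_part_at _ (point_eval p) (G \Po S).
  by rewrite comp_poly2_eq0 // size_chart.
have vz : v z = v (val (centered q)) - v (val (centered p)).
  by rewrite (valuationM v_xi) ?invr_eq0 // (valuationV v_xi).
pose P := map_poly (horner_alg (val p)) H.
have coefP k : P`_k = val (horner_alg p H`_k).
  by rewrite coef_map /= -(biv_inner (val p) (val p)) -val_biv biv_inner.
apply: (unit_coef_root_local v_xi (leqnn (size P))).
- have : biv (val p) z (G \Po S) = 0.
    rewrite biv_comp biv_chart (_ : _ + _ = val q); first by rewrite -val_biv pqG.
    by rewrite -[val p - _]/(val (centered p)) mulrC divfK // addrC subrK.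
  rewrite eH bivZ !rmorphXn /= biv_inner rmorphB /= horner_algX horner_algC.
  by move/eqP; rewrite mulf_eq0 expf_eq0 -[val p - _]/(val (centered p)) (negbTE vp0) andbF.
- by move=> k; rewrite coefP; apply: local_valP.
- exists i; rewrite coefP -/(point_eval _) -(biv_inner p p) point_eval_biv hornerC.
  exact: hi.
- by rewrite mulf_neq0 ?invr_eq0.
- by rewrite vz subr_ge0.
Qed.

(** The transformed relation is divisible by the square of the equation of the
    exceptional line, because the relation has no linear term at the point: the
    derivative in [q] vanishes there by assumption, and the remaining linear term cannot
    be balanced by terms of higher order since [p] has the smaller value. *)
Lemma blow_up p q G : centered p != 0 -> centered q != 0 -> generates p q ->
    biv p q G = 0 -> biv p q G^`() != 0 -> point_eval (biv p q G^`()) = 0 ->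
    v (val (centered p)) <= v (val (centered q)) ->
  exists r H, [/\ generates p r, biv p r H = 0 &
    centered p * biv p r H^`() = biv p q G^`()].
Proof.
move=> p0 q0 pq pqG dG0 edG vpq.
have G0 : G != 0 by apply: contraNneq dG0 => ->; rewrite deriv0 rmorph0.
have [r er] := slope_local p0 q0 G0 pqG vpq.
set c := point_eval p; set d := point_eval q in er; set D := 'X - c%:P.
pose S := chart c d.
have prS : biv p r S = q by rewrite biv_chart [RHS]er.
have prD : biv p r D%:P = centered p.
  by rewrite biv_inner rmorphB /= horner_algX horner_algC.
have rootD (h : {poly R}) : h.[c] = 0 -> exists h', h = h' * D.
  by move=> e; have /factor_theorem : root h c by apply/rootP.
have [G1 eG1] : exists G1, G - G.[d%:P]%:P = G1 * ('X - d%:P%:P).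
  by apply/factor_theorem; rewrite rootE !hornerE subrr.
have [G2 eG2] : exists G2, G1 - G1.[d%:P]%:P = G2 * ('X - d%:P%:P).
  by apply/factor_theorem; rewrite rootE !hornerE subrr.
set a0 := G.[d%:P] in eG1; set a1 := G1.[d%:P] in eG2.
have eG : G = a0%:P + (a1%:P + G2 * ('X - d%:P%:P)) * ('X - d%:P%:P).
  by rewrite -eG2 (addrC a1%:P) subrK -eG1 addrC subrK.
have a0c : a0.[c] = 0 by rewrite /a0 -point_eval_biv pqG rmorph0.
have dGd : G^`().[d%:P] = a1.
  by rewrite eG !derivE !hornerE /= subrr !mulr0 add0r addr0.
have a1c : a1.[c] = 0 by rewrite -dGd -point_eval_biv.
have [h eh] := rootD _ a0c; have [l el] := rootD _ a1c.
(* The terms of [G] of degree 0, 1 and at least 2 in [q - q0], transformed. *)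
have GS : G \Po S = D *: (h%:P + 'X * D%:P * (l%:P + 'X * (G2 \Po S))).
  have eS : ('X - d%:P%:P) \Po S = D%:P * 'X.
    by rewrite comp_polyB comp_polyX comp_polyC /S /chart addrC addKr.
  rewrite {1}eG comp_polyD comp_polyM comp_polyD comp_polyM !comp_polyC eS eh el -mul_polyC !polyCM.
  ring.
have prGS : biv p r (G \Po S) = 0 by rewrite biv_comp prS.
(* [D] divides the transformed relation; the quotient vanishes at the point. *)
have hc : h.[c] = 0.
  move: prGS; rewrite GS bivZ prD -[RHS](mulr0 (centered p)) => /(local_mulI p0).
  rewrite rmorphD !rmorphM /= prD => /(congr1 (@point_eval _ _ _ _ xi)).
  rewrite rmorph0 rmorphD !rmorphM /= point_eval_centered mulr0 mul0r addr0.
  by rewrite point_eval_biv hornerC.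
have [k ek] := rootD _ hc.
pose H := k%:P + 'X * (l%:P + 'X * (G2 \Po S)).
have eH : G \Po S = D ^+ 2 *: H.
  by rewrite GS ek /H -!mul_polyC !polyCM; ring.
exists r, H; split.
- move=> z; have [P [Q [Q0 ez]]] := pq z.
  by exists (P \Po S), (Q \Po S); rewrite !biv_comp !prS.
- move: prGS; rewrite eH bivZ !rmorphXn /= prD.
  rewrite -[RHS](mulr0 (centered p ^+ 2)); apply: local_mulI.
  by rewrite expr2 local_neq0.
have : biv p r (G \Po S)^`() = biv p q G^`() * centered p.
  rewrite deriv_comp rmorphM /= biv_comp prS; congr (_ * _).
  by rewrite /S /chart derivD derivC derivM derivC derivX mul0r mulr1 !add0r prD.
rewrite eH derivZ bivZ !rmorphXn /= prD expr2 -mulrA [RHS]mulrC.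
exact: local_mulI.
Qed.

Definition regular_pair p q := [/\ centered p != 0, generates p q &
  exists G, biv p q G = 0 /\ point_eval (biv p q G^`()) != 0].

(** Each blow up decreases the value of the derivative of the relation and keeps [p];
    if the new coordinate has smaller value than [p], the two are exchanged. *)
Lemma resolution p q G : centered p != 0 -> generates p q -> biv p q G = 0 ->
  biv p q G^`() != 0 -> exists p' q', regular_pair p' q'.
Proof.
move=> p0; have [k] := valuation_nat v_xi p0; have [n] := ubnP k.
elim: n k p p0 q G => // n IH k p p0 q G kn ek pq pqG dG0.
have [e] := valuation_nat v_xi dG0; have [d] := ubnP e.
elim: d e q G pq pqG dG0 => // d IHd e q G pq pqG dG0 ed ee.
have [edG|edG] := eqVneq (point_eval (biv p q G^`())) 0; last by exists p, q; split=> //; exists G.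
have [q0|q0] := eqVneq (centered q) 0.
  exists p, q; split=> //; exists ('X - (point_eval q)%:P%:P).
  rewrite derivXsubC rmorph1 rmorph1 oner_neq0; split=> //.
  by rewrite biv_XsubC; exact: q0.
have G0 : G != 0 by apply: contraNneq dG0 => ->; rewrite deriv0 rmorph0.
have [vpq|vqp] := leP (v (val (centered p))) (v (val (centered q))).
  have [r [H [pr prH eH]]] := blow_up p0 q0 pq pqG dG0 edG vpq.
  have dH0 : biv p r H^`() != 0.
    by apply: contraNneq dG0 => h; rewrite -eH h mulr0.
  have [e1 ee1] := valuation_nat v_xi dH0.
  apply: (IHd e1 r H) => //.
  move: ee (valuation_local_gt0 v_xi p0 (point_eval_centered p)).
  by rewrite -eH (valuation_local_mul v_xi) // ee1; lia.
have [H [qpH dH0]] := relation_swap q0 G0 pqG.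
have [k1 ek1] := valuation_nat v_xi q0.
by apply: (IH k1 q q0 p H) => //; [lia|exact: generates_swap].
Qed.

End Resolution.
(** * The local ring at a regular pair *)

Section RegularPair.
Variables (R : realType) (K : fieldAlgType R) (x y : K) (xi : real_point x y).
Variable (v : K -> int).
Hypothesis v_xi : valuation_centered xi v.
Local Notation L := (local_ring xi).
Variables (p q : L) (G : {poly {poly R}}).
Hypotheses (p0 : centered p != 0) (pq : generates p q).
Hypotheses (pqG : biv p q G = 0) (dG : point_eval (biv p q G^`()) != 0).
Implicit Types (f g : L) (P Q : {poly {poly R}}).
Local Notation pi := (centered p).
Local Notation unit_poly Q := (point_eval (biv p q Q) != 0).

Lemma unit_polyM P Q : unit_poly P -> unit_poly Q -> unit_poly (P * Q).
Proof. by move=> P0 Q0; rewrite bivM point_evalM; apply: mulf_neq0 P0 Q0. Qed.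

Lemma biv_root_inner (c : {poly R}) : c.[point_eval p] = 0 ->
  exists h : {poly R}, biv p q c%:P = biv p q h%:P * pi.
Proof.
move=> /rootP/factor_theorem[h ->]; exists h.
by rewrite !biv_inner rmorphM rmorphB /= horner_algX horner_algC.
Qed.

(** The relation [G(p, q) = 0] expresses [q - q0] as a multiple of [p - p0] by an
    element with denominator [(G - G(p, q0)) / (q - q0)], a unit at the point. *)
Lemma vanishing_divisible P : point_eval (biv p q P) = 0 ->
  exists P' Q, unit_poly Q /\ biv p q P * biv p q Q = pi * biv p q P'.
Proof.
move=> eP; set c := point_eval p; set d := point_eval q.
have expand H : exists H1, H = H.[d%:P]%:P + H1 * ('X - d%:P%:P).
  have /factor_theorem[H1 eH] : root (H - H.[d%:P]%:P) d%:P by rewrite rootE !hornerE subrr.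
  by exists H1; rewrite -eH addrC subrK.
have [P1 eP1] := expand P; have [G1 eG1] := expand G.
have [|h eh] := @biv_root_inner P.[d%:P]; first by rewrite -point_eval_biv.
have [|k ek] := @biv_root_inner G.[d%:P]; first by rewrite -point_eval_biv pqG rmorph0.
exists (h%:P * G1 - P1 * k%:P), G1; split.
  rewrite point_eval_biv (_ : G1.[d%:P] = G^`().[d%:P]) -?point_eval_biv //.
  rewrite {1}eG1 derivD derivC add0r derivM derivXsubC mulr1 hornerD hornerM.
  by rewrite hornerXsubC subrr mulr0 add0r.
have eG0 : biv p q G1 * centered q = - (biv p q k%:P * pi).
  have := congr1 (biv p q) eG1; rewrite pqG rmorphD rmorphM /= biv_XsubC ek.
  by move=> /esym/eqP; rewrite addrC addr_eq0 => /eqP.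
rewrite {1}eP1 rmorphD rmorphM /= biv_XsubC -/(centered q) eh.
rewrite bivB !rmorphM /=.
rewrite (_ : (_ + _) * _ = biv p q h%:P * pi * biv p q G1 +
   biv p q P1 * (biv p q G1 * centered q)); last by ring.
by rewrite eG0; ring.
Qed.

(** Each application of [vanishing_divisible] lowers the value. *)
Lemma poly_factor P : biv p q P != 0 -> exists j P' Q,
  [/\ unit_poly P', unit_poly Q & biv p q P * biv p q Q = pi ^+ j * biv p q P'].
Proof.
move=> P0; have [k] := valuation_nat v_xi P0; have [n] := ubnP k.
elim: n k P P0 => // n IH k P P0 kn ek.
have [eP|eP] := eqVneq (point_eval (biv p q P)) 0; last first.
  by exists 0, P, 1; rewrite rmorph1 rmorph1 oner_neq0 mulr1 mul1r.
have [P' [Q [Q0 e]]] := vanishing_divisible eP.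
have P'0 : biv p q P' != 0.
  apply: contraTneq (local_neq0 P0 (point_eval_neq0 Q0)) => e'.
  by rewrite e e' mulr0 eqxx.
have [k' ek'] := valuation_nat v_xi P'0.
have [|j [P'' [Q' [P''0 Q'0 e']]]] := IH k' P' P'0 _ ek'.
  have : v (val (biv p q P * biv p q Q)) = v (val (pi * biv p q P')) by rewrite e.
  rewrite (valuation_local_mul v_xi P0 (point_eval_neq0 Q0)) (valuation_local_mul v_xi p0 P'0).
  rewrite ek ek' (valuation_unit v_xi Q0).
  by move: (valuation_local_gt0 v_xi p0 (point_eval_centered p)); lia.
exists j.+1, P'', (Q * Q'); split; [exact: P''0|exact: unit_polyM|].
by rewrite bivM mulrA e -mulrA e' exprS mulrA.
Qed.

Lemma point_eval_unit f g : f * g = 1 -> point_eval f != 0.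
Proof.
move=> fg; apply/eqP => e; have := point_evalM f g.
by rewrite fg e mul0r point_eval1 => /eqP; rewrite oner_eq0.
Qed.

Lemma local_fraction f : f != 0 -> exists k P Q,
  [/\ unit_poly P, unit_poly Q & f * biv p q Q = pi ^+ k * biv p q P].
Proof.
move=> f0; have [P [Q [Q0 ef]]] := pq (val f).
have efQ : f * biv p q Q = biv p q P.
  by apply: val_inj; rewrite local_valM ef divfK // local_val_eq0.
have P0 : biv p q P != 0 by rewrite -efQ local_neq0.
have [i [P1 [Q1 [P10 Q10 e1]]]] := poly_factor P0.
have [j [P2 [Q2 [P20 Q20 e2]]]] := poly_factor Q0.
have e : f * (pi ^+ j * (biv p q P2 * biv p q Q1)) = pi ^+ i * (biv p q P1 * biv p q Q2).
  rewrite mulrA [_ * (_ * biv p q Q2)]mulrA -e1 -efQ (_ : f * pi ^+ j * _ =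
    f * (pi ^+ j * biv p q P2) * biv p q Q1); last by ring.
  by rewrite -e2; ring.
have u1 := unit_polyM P20 Q10; have u2 := unit_polyM P10 Q20.
rewrite -!bivM in e.
have pin k : pi ^+ k != 0 := local_exp_neq0 k p0.
have lji : (j <= i)%N.
  have pj := local_neq0 (pin j) (point_eval_neq0 u1).
  have : v (val (f * (pi ^+ j * biv p q (P2 * Q1)))) =
    v (val (pi ^+ i * biv p q (P1 * Q2))) by rewrite e.
  rewrite (valuation_local_mul v_xi f0 pj) (valuation_local_mul v_xi (pin j) (point_eval_neq0 u1)).
  rewrite (valuation_local_mul v_xi (pin i) (point_eval_neq0 u2)).
  rewrite (valuation_unit v_xi u1) (valuation_unit v_xi u2) !(valuation_local_exp v_xi _ p0).
  have [k ->] := valuation_nat v_xi f0; move: (valuation_local_gt0 v_xi p0 (point_eval_centered p)).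
  have [l ->] := valuation_nat v_xi p0; rewrite !addr0 ltz_nat => l_gt0 eij.
  have {}eij : (k + l * j = l * i)%N by clear -eij; lia.
  by rewrite -(leq_pmul2l l_gt0) -eij leq_addl.
exists (i - j)%N, (P1 * Q2), (P2 * Q1); split; [exact: u2|exact: u1|].
apply: (local_mulI (pin j)).
by rewrite mulrCA e mulrA -exprD subnKC.
Qed.

Lemma local_factor f : f != 0 -> exists k g, point_eval g != 0 /\ f = pi ^+ k * g.
Proof.
move=> f0; have [k [P [Q [P0 Q0 e]]]] := local_fraction f0.
have [g Qg] := local_unit Q0; exists k, (biv p q P * g); split.
  rewrite point_evalM; apply: mulf_neq0 P0 _.
  by apply: (@point_eval_unit _ (biv p q Q)); rewrite mulrC.
by rewrite mulrA -e -mulrA Qg mulr1.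
Qed.

(** A uniformizer is a unit times [p - p0], since its value is a multiple of the value
    of [p - p0]. *)
Lemma uniformizer_factor t : uniformizer v t ->
  exists g, point_eval g != 0 /\ t = pi * g.
Proof.
move=> [t0 vt]; have [k [g [g0 e]]] := local_factor t0; exists g; split=> //.
suff k1 : k = 1%N by rewrite e k1 expr1.
have pik : pi ^+ k != 0 by apply: contraNneq t0 => h; rewrite e h mul0r.
move: vt; rewrite e (valuation_local_mul v_xi) ?(point_eval_neq0 g0) //.
rewrite (valuation_unit v_xi g0) (valuation_local_exp v_xi) // addr0.
have [l ->] := valuation_nat v_xi p0 => elk; have {elk} : (l * k == 1)%N by clear -elk; lia.
by rewrite muln_eq1 => /andP[_ /eqP].
Qed.

Lemma factor_uniformizer t f k : uniformizer v t -> f != 0 -> v (val f) = k%:Z ->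
  exists g, point_eval g != 0 /\ f = t ^+ k * g.
Proof.
move=> ut f0 vf; have [g [g0 et]] := uniformizer_factor ut.
have [j [h [h0 ef]]] := local_factor f0; have [w gw] := local_unit g0.
have w0 : point_eval w != 0 by apply: (@point_eval_unit _ g); rewrite mulrC.
have efw : f = t ^+ j * (w ^+ j * h).
  by rewrite mulrA -exprMn et -mulrA gw mulr1.
have u : point_eval (w ^+ j * h) != 0 by rewrite point_evalM rmorphXn mulf_neq0 ?expf_neq0.
exists (w ^+ j * h); split=> //; rewrite {1}efw; congr (_ ^+ _ * _).
have [t0 vt] := ut.
have tj : t ^+ j != 0 by apply: contraNneq f0 => e; rewrite efw e mul0r.
move: vf; rewrite efw (valuation_local_mul v_xi) ?(point_eval_neq0 u) //.
by rewrite (valuation_unit v_xi u) (valuation_local_exp v_xi) // vt addr0 => vf; clear -vf; lia.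
Qed.

(** Every element of the local ring is a fraction of polynomials in [p] and [q]. *)
Lemma regular_delta_gen f : diag_gen p q (delta f).
Proof.
have [->|f0] := eqVneq f 0.
  by rewrite -(scale0r (1 : L)); apply: delta_alg_in.
have [k [P [Q [P0 Q0 e]]]] := local_fraction f0; have [g Qg] := local_unit Q0.
have -> : f = g * biv p q (('X - (point_eval p)%:P)%:P ^+ k * P).
  rewrite rmorphM rmorphXn /= biv_inner rmorphB /= horner_algX horner_algC.
  by rewrite -/(centered p) -e mulrCA [g * _]mulrC Qg mulr1.
by apply: (delta_div_in Qg); apply: biv_diag_gen.
Qed.

(** Differentiating the relation gives [G_X dp + G_Y dq = 0] with [G_Y] a unit. *)
Lemma regular_dq_dp : exists a, diag_gen2 p q (delta q - (1 \ox a) * delta p).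
Proof.
have [a] := biv_taylor p q G; rewrite pqG -(scale0r (1 : L)) delta_alg => h.
have [g dGg] := local_unit dG; have [_ _ IM] := diag_gen2_ideal p q.
exists (- (g * a)); move: (IM (- (1 \ox g)) _ h); congr (diag_gen2 _ _ _).
have e : delta q = (1 \ox g) * (1 \ox biv p q G^`()) * delta q.
  by rewrite -tensrM [g * _]mulrC dGg tens11 mul1r.
by rewrite [in RHS]e tensNr tensrM; ring.
Qed.

End RegularPair.
(** * The derivation with respect to [s] *)

Section Ddiff.
Variables (R : comNzRingType) (A : comAlgType R) (s : A).
Hypothesis s_free : kaehler_free s.
Implicit Types (f g a : A) (w : tensor A A).

Lemma in_diag2_ideal : is_ideal (@in_diag2 R A).
Proof.
split=> [|_ _ [k [hk ->]] [l [hl ->]]|c _ [l [hl ->]]].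
- by exists [::]; rewrite big_nil.
- exists (k ++ l); rewrite big_cat; split=> // u.
  by rewrite mem_cat => /orP[/hk|/hl].
exists [seq (c * u.1, u.2) | u <- l]; rewrite big_map mulr_sumr; split.
  move=> _ /mapP[u /hl[u1 u2] ->]; split=> //=.
  by rewrite /in_diag tens_prodM u1 mulr0.
by apply: eq_bigr => u _; rewrite mulrA.
Qed.

Lemma in_diag2_mul u w : in_diag u -> in_diag w -> in_diag2 (u * w).
Proof.
move=> u0 w0; exists [:: (u, w)]; rewrite big_seq1; split=> // e.
by rewrite inE => /eqP ->.
Qed.

Lemma ddiffP f : in_diag2 (delta f - (1 \ox ddiff s f) * delta s).
Proof.
have [a [ha _]] := s_free (delta_diag f).
by rewrite /ddiff; case: xgetP => [b -> //|h]; case: (h a).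
Qed.

(** Uniqueness turns every rule of calculus modulo the squared diagonal ideal into an
    identity for [ddiff s]. *)
Lemma ddiff_unique f a : in_diag2 (delta f - (1 \ox a) * delta s) -> ddiff s f = a.
Proof.
have [b [_ ub]] := s_free (delta_diag f).
by move=> /ub <-; rewrite (ub _ (ddiffP f)).
Qed.

Lemma ddiffD : {morph ddiff s : f g / f + g}.
Proof.
move=> f g; apply: ddiff_unique; have [_ ID _] := in_diag2_ideal.
move: (ID _ _ (ddiffP f) (ddiffP g)); congr in_diag2.
by rewrite deltaD tensDr; ring.
Qed.

Lemma ddiffM f g : ddiff s (f * g) = f * ddiff s g + g * ddiff s f.
Proof.
apply: ddiff_unique; have [_ ID IM] := in_diag2_ideal.
have h := ID _ _ (IM (1 \ox f) _ (ddiffP g)) (IM (1 \ox g) _ (ddiffP f)).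
move: (ID _ _ h (in_diag2_mul (delta_diag f) (delta_diag g))); congr in_diag2.
by rewrite deltaM tensDr !tensrM; ring.
Qed.

Lemma ddiff_alg (c : R) : ddiff s c%:A = 0.
Proof.
apply: ddiff_unique; rewrite delta_alg tens0r mul0r subrr.
by have [] := in_diag2_ideal.
Qed.

Lemma ddiff_s : ddiff s s = 1.
Proof. by apply: ddiff_unique; rewrite tens11 mul1r subrr; have [] := in_diag2_ideal. Qed.

End Ddiff.

(** * Derivations detect differentials *)

Section DerivationForm.
Variables (R : comNzRingType) (A : comAlgType R) (D : A -> A).
Hypothesis D_add : {morph D : f g / f + g}.
Hypothesis D_mul : forall f g, D (f * g) = f * D g + g * D f.
Hypothesis D_alg : forall c : R, D c%:A = 0.

(** The additive map from differentials to [A] given by the derivation; it is defined on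
    the whole tensor product and kills the square of the diagonal ideal. *)
Definition derivation_form : tensor A A -> A := tens_lift (fun f g => D f * g).

Lemma derivation_form_balanced : balanced (fun f g => D f * g).
Proof.
split=> [*|*|c f g]; rewrite ?D_add ?mulrDl ?mulrDr //.
by rewrite -mulr_algl D_mul D_alg mulr0 addr0 mulr_algl -scalerAl -scalerAr.
Qed.

Lemma derivation_formD u w : derivation_form (u + w) = derivation_form u + derivation_form w.
Proof. exact: (tens_liftD derivation_form_balanced). Qed.

Lemma derivation_formE f g : derivation_form (f \ox g) = D f * g.
Proof. exact: (tens_liftE derivation_form_balanced). Qed.

Lemma derivation_form0 : derivation_form 0 = 0.
Proof. exact: (tens_lift0 derivation_form_balanced). Qed.

Lemma derivation_formM u w : derivation_form (u * w) =
  derivation_form u * tens_prod w + tens_prod u * derivation_form w.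
Proof.
elim/tens_ind: u => [|f g u IH].
  by rewrite mul0r derivation_form0 raddf0 !mul0r addr0.
rewrite mulrDl !derivation_formD IH (raddfD (@tens_prod R A)) /= !mulrDl addrACA.
congr (_ + _); rewrite tens_prodE derivation_formE.
elim/tens_ind: w {IH} => [|f' g' w IH].
  by rewrite mulr0 derivation_form0 raddf0 !mulr0 addr0.
rewrite mulrDr !derivation_formD IH (raddfD (@tens_prod R A)) /= tensM.
by rewrite !derivation_formE tens_prodE D_mul; ring.
Qed.

Lemma derivation_form_squares p q w : diag_squares p q w -> derivation_form w = 0.
Proof.
have prod_delta f : tens_prod (delta f) = 0 by exact: delta_diag.
move=> [a [b [_ _ ->]]]; rewrite !expr2 derivation_formD !derivation_formM.
by rewrite !tens_prodM !prod_delta !(mulr0, mul0r, addr0).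
Qed.

Lemma derivation_1 : D 1 = 0.
Proof. by rewrite -(scale1r (1 : A)) D_alg. Qed.

Lemma derivation_form_delta f : derivation_form (delta f) = D f.
Proof.
apply: (addIr (derivation_form (1 \ox f))); rewrite -derivation_formD subrK.
by rewrite !derivation_formE derivation_1 mul0r addr0 mulr1.
Qed.

(** [derivation_form] sends [delta f] to [D f] and [(1 \ox c) * delta g] to [c * D g]. *)
Lemma derivation_congr p q f g c :
  diag_squares p q (delta f - (1 \ox c) * delta g) -> D f = c * D g.
Proof.
move=> /derivation_form_squares h; apply/eqP; rewrite -subr_eq0 -h.
have eN u : derivation_form (- u) = - derivation_form u.
  by apply/eqP; rewrite -addr_eq0 -derivation_formD addNr derivation_form0.
rewrite derivation_formD eN derivation_formM !derivation_form_delta tens_prodE.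
rewrite (_ : tens_prod (delta g) = 0); last exact: delta_diag.
by rewrite mulr0 add0r mul1r.
Qed.

End DerivationForm.

Section Localization.
Variables (R : realType) (K : fieldAlgType R) (x y : K) (xi : real_point x y).
Variables (U : affine_nbhd xi) (s : coord_ring U).
Hypothesis s_free : kaehler_free s.
Local Notation L := (local_ring xi).
Local Notation tau := (@to_local R K x y xi U).
Implicit Types (f g h : L) (a b : coord_ring U).

Lemma to_localM a b : tau (a * b) = tau a * tau b.
Proof. exact: val_inj. Qed.

Lemma to_localD a b : tau (a + b) = tau a + tau b.
Proof. exact: val_inj. Qed.

Lemma to_local1 : tau 1 = 1.
Proof. exact: val_inj. Qed.

Lemma to_local_inj : injective tau.
Proof. by move=> a b e; apply: val_inj; exact: (congr1 val e). Qed.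

Lemma to_local_alg (c : R) : tau c%:A = c%:A.
Proof. exact: val_inj. Qed.

Lemma local_quotient f : exists a b,
  [/\ tau b != 0, f * tau b = tau a & exists g, tau b * g = 1].
Proof.
have /local_atP[c [d [d0 e]]] := local_valP f.
have reg (a : nring x y) := integral_closure_regular (nbhd_eqns U) (nring_valP a).
have ed : val (tau (OpenRing (reg d))) = val d / val (1 : nring x y) by rewrite divr1.
exists (OpenRing (reg c)), (OpenRing (reg d)); split.
- by rewrite -local_val_eq0; exact: xi_neq0 d0.
- apply: val_inj; rewrite local_valM -[val f]/(local_val f) e /=.
  by rewrite divfK // (xi_neq0 d0).
- apply: local_unit; rewrite /point_eval ed eval_atE ?rmorph1 ?oner_neq0 ?divr1 //.
Qed.

(** The quotient rule extends the derivation; it does not depend on the fraction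
    because [a * b' = a' * b] may be differentiated. *)
Lemma derivative_exists f : exists g, forall a b, f * tau b = tau a ->
  g * tau b = tau (ddiff s a) - f * tau (ddiff s b).
Proof.
have [g [h [h0 e [w hw]]]] := local_quotient f.
exists ((tau (ddiff s g) - f * tau (ddiff s h)) * w) => a b e'.
have /to_local_inj eq : tau (a * h) = tau (g * b).
  by rewrite !to_localM -e -e'; ring.
have := congr1 (fun z => tau (ddiff s z)) eq.
rewrite /= !ddiffM // !to_localD !to_localM -e -e' => eq'.
apply: (local_mulI h0).
rewrite (_ : tau h * (_ * w * tau b) = (tau h * w) *
  ((tau (ddiff s g) - f * tau (ddiff s h)) * tau b)); last by ring.
rewrite hw mul1r; apply/eqP; rewrite -subr_eq0; move/eqP: eq'; rewrite -subr_eq0.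
move=> /eqP eq'; apply/eqP; rewrite -[RHS]oppr0 -eq'; ring.
Qed.

Lemma local_derivation : exists D : L -> L,
  [/\ {morph D : f g / f + g}, forall f g, D (f * g) = f * D g + g * D f,
      forall c : R, D c%:A = 0 & forall a, D (tau a) = tau (ddiff s a)].
Proof.
have /choice[D hD] := derivative_exists; exists D.
have D_tau a : D (tau a) = tau (ddiff s a).
  have := hD (tau a) a 1; rewrite to_local1 !mulr1 => -> //.
  by rewrite -(scale1r (1 : coord_ring U)) ddiff_alg // (raddf0 tau) mulr0 subr0.
split=> [f g|f g|c|//].
- have [a [b [b0 e _]]] := local_quotient f; have [a' [b' [b'0 e' _]]] := local_quotient g.
  have h := hD _ _ _ e; have h' := hD _ _ _ e'.
  apply: (local_mulI (local_neq0 b0 b'0)); rewrite -to_localM mulrC.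
  rewrite (hD (f + g) (a * b' + a' * b) (b * b')).
    rewrite !ddiffD // !ddiffM // !to_localD !to_localM -e -e'.
    rewrite (_ : tau b * tau b' * (D f + D g) =
      (D f * tau b) * tau b' + (D g * tau b') * tau b); last by ring.
    by rewrite h h'; ring.
  by rewrite !to_localD !to_localM -e -e'; ring.
- have [a [b [b0 e _]]] := local_quotient f; have [a' [b' [b'0 e' _]]] := local_quotient g.
  have h := hD _ _ _ e; have h' := hD _ _ _ e'.
  apply: (local_mulI (local_neq0 b0 b'0)); rewrite -to_localM mulrC.
  rewrite (hD (f * g) (a * a') (b * b')).
    rewrite !ddiffM // !to_localD !to_localM -e -e'.
    rewrite (_ : tau b * tau b' * (f * D g + g * D f) =
      f * (D g * tau b') * tau b + g * (D f * tau b) * tau b'); last by ring.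
    by rewrite h h'; ring.
  by rewrite !to_localM -e -e'; ring.
- by rewrite -to_local_alg D_tau ddiff_alg // (raddf0 tau).
Qed.

Lemma tens_map_to_local_pure a b : tens_map tau (a \ox b) = tau a \ox tau b.
Proof. exact: (tens_liftE (tens_map_balanced tau)). Qed.

Lemma tens_map_to_localB : {morph tens_map tau : u w / u - w}.
Proof. exact: (tens_liftB (tens_map_balanced tau)). Qed.

Lemma tens_map_to_localM : {morph tens_map tau : u w / u * w}.
Proof.
apply: (tens_liftM (tens_map_balanced tau)) => a b a' b'.
by rewrite tensM; congr (_ \ox _); apply: to_localM.
Qed.

Lemma tens_map_delta a : tens_map tau (delta a) = delta (tau a).
Proof. by rewrite /delta tens_map_to_localB !tens_map_to_local_pure to_local1. Qed.

End Localization.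
(** * Normal form of the curve and conclusion *)

Section Conclusion.
Variables (R : realType) (K : fieldAlgType R) (x y : K) (xi : real_point x y).
Variable (v : K -> int).
Hypothesis v_xi : valuation_centered xi v.
Variables (U : affine_nbhd xi) (s : coord_ring U).
Hypothesis s_free : kaehler_free s.
Local Notation L := (local_ring xi).
Local Notation tau := (@to_local R K x y xi U).
Implicit Types (f g : L).

Lemma valuation_scale (c : R) f : c != 0 -> f != 0 -> v (val (c%:A * f)) = v (val f).
Proof.
move=> c0 f0; have e : point_eval (c%:A : L) != 0 by rewrite point_eval_alg.
by rewrite (valuation_local_mul v_xi (point_eval_neq0 e) f0) (valuation_unit v_xi e) add0r.
Qed.

Lemma alg_neq0 (c : R) : c != 0 -> (c%:A : L) != 0.
Proof. by move=> c0; apply: point_eval_neq0; rewrite point_eval_alg. Qed.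

(** Multiplication by a nonzero constant does not change the value. *)
Lemma values_independent f g (c d : R) : f != 0 -> g != 0 ->
  v (val f) <> v (val g) -> c%:A * f = d%:A * g -> c = 0 /\ d = 0.
Proof.
move=> f0 g0 vfg e.
have [c0|c0] := eqVneq c 0.
  split=> //; apply/eqP; apply: contraT => d0.
  by move: (local_neq0 (alg_neq0 d0) g0); rewrite -e c0 scale0r mul0r eqxx.
have [d0|d0] := eqVneq d 0.
  by move: (local_neq0 (alg_neq0 c0) f0); rewrite e d0 scale0r mul0r eqxx.
by case: vfg; rewrite -(valuation_scale c0 f0) e valuation_scale.
Qed.

Definition x_local : L := tau (open_x (nbhd_eqns U)).
Definition y_local : L := tau (open_y (nbhd_eqns U)).

Definition combination (a b c : R) : L := a%:A + b%:A * x_local + c%:A * y_local.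

Lemma scalarD (a b : R) : (a + b)%:A = a%:A + b%:A :> L.
Proof. exact: scalerDl. Qed.

Lemma scalarB (a b : R) : (a - b)%:A = a%:A - b%:A :> L.
Proof. exact: scalerBl. Qed.

Lemma scalarM (a b : R) : (a * b)%:A = a%:A * b%:A :> L.
Proof. by rewrite mulr_algl scalerA. Qed.

Lemma combination_centered a b c : point_eval (combination a b c) = 0 ->
  combination a b c = b%:A * centered x_local + c%:A * centered y_local.
Proof.
move=> e; set f := combination a b c in e *.
pose k := a + b * point_eval x_local + c * point_eval y_local.
have ef : f = k%:A + (b%:A * centered x_local + c%:A * centered y_local).
  by rewrite /f /combination /k /centered !scalarD !scalarM; ring.
suff k0 : k = 0 by rewrite ef k0 scale0r add0r.
rewrite -[LHS](@point_eval_alg _ _ _ _ xi).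
have -> : k%:A = f - (b%:A * centered x_local + c%:A * centered y_local) by rewrite ef addrK.
rewrite (@point_evalB _ _ _ _ xi f) e.
rewrite (raddfD (@point_eval _ _ _ _ xi)) /=.
rewrite (point_evalM b%:A) (point_evalM c%:A) !point_eval_centered !mulr0 addr0.
exact: subr0.
Qed.

(** The value set provides two functions in the span of [1], [x], [y]; as they vanish
    at the point, they are combinations of the centered coordinates, and the different
    values make the matrix of coefficients invertible. *)
Lemma adapted_coordinates m n : (0 < m)%N -> (m < n)%N -> value_set x y v m n ->
  exists a1 b1 c1 a2 b2 c2,
  [/\ v (val (combination a1 b1 c1)) = m%:Z, combination a1 b1 c1 != 0,
      v (val (combination a2 b2 c2)) = n%:Z, combination a2 b2 c2 != 0 &
      b1 * c2 - c1 * b2 != 0 /\ centered x_local != 0].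
Proof.
move=> m_gt0 lmn vals.
have get k : (k = m \/ k = n) -> exists a b c,
    v (val (combination a b c)) = k%:Z /\ combination a b c != 0.
  move=> hk; have : [set 0; m%:Z; n%:Z]%classic k%:Z.
    by case: hk => ->; [left; right|right].
  rewrite -vals => -[a [b [c [f0 ->]]]]; exists a, b, c.
  have e : val (combination a b c) = a%:A + b *: x + c *: y.
    by rewrite -(mulr_algl b x) -(mulr_algl c y).
  by split; [rewrite e|rewrite -local_val_eq0 e].
have [a1 [b1 [c1 [v1 f1]]]] := get m (or_introl erefl).
have [a2 [b2 [c2 [v2 f2]]]] := get n (or_intror erefl).
exists a1, b1, c1, a2, b2, c2; split=> //.
have ev0 a b c (k : nat) : (0 < k)%N -> v (val (combination a b c)) = k%:Z ->
    combination a b c = b%:A * centered x_local + c%:A * centered y_local.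
  move=> k_gt0 vk; apply: combination_centered.
  apply/eqP; apply: contraT => /(valuation_unit v_xi); rewrite vk => h.
  by move: k_gt0; case: (k) h.
have e1 := ev0 _ _ _ _ m_gt0 v1; have e2 := ev0 _ _ _ _ (ltn_trans m_gt0 lmn) v2.
move: v1 f1 e1 v2 f2 e2; set F := combination a1 b1 c1; set H := combination a2 b2 c2.
move=> v1 f1 e1 v2 f2 e2.
have vFH : v (val F) <> v (val H) by rewrite v1 v2 => -[e]; move: lmn; rewrite e ltnn.
have indep c d := @values_independent F H c d f1 f2 vFH.
have det0 : b1 * c2 - c1 * b2 != 0.
  apply/eqP => det; have {}det : b1%:A * c2%:A = c1%:A * b2%:A :> L.
    by rewrite -!scalarM; congr (_%:A); apply/eqP; rewrite -subr_eq0 det.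
  have [b20 b10] : b2 = 0 /\ b1 = 0.
    apply: indep; rewrite e1 e2 !mulrDr !(mulrA b2%:A) !(mulrA b1%:A) det.
    by congr (_ + _); rewrite ?(mulrC b2%:A).
  have [c20 c10] : c2 = 0 /\ c1 = 0.
    apply: indep; rewrite e1 e2 !mulrDr !(mulrA c2%:A) !(mulrA c1%:A) -det.
    by congr (_ + _); rewrite ?(mulrC c2%:A).
  by move: f1; rewrite e1 b10 c10 !scale0r !mul0r addr0 eqxx.
split; first exact: det0.
apply: contraNneq det0 => cx0.
have [c20 c10] : c2 = 0 /\ c1 = 0.
  by apply: indep; rewrite e1 e2 cx0 !mulr0 !add0r !mulrA (mulrC c2%:A).
by rewrite c20 c10 mulr0 mul0r subr0.
Qed.

Lemma delta_combination a b c : delta (combination a b c) =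
  (1 \ox b%:A) * delta x_local + (1 \ox c%:A) * delta y_local.
Proof. by rewrite /combination !deltaD !deltaM !delta_alg; ring. Qed.

Lemma derivation_combination (D : L -> L) a b c : {morph D : f g / f + g} ->
    (forall f g, D (f * g) = f * D g + g * D f) -> (forall k : R, D k%:A = 0) ->
  D (combination a b c) = b%:A * D x_local + c%:A * D y_local.
Proof. by move=> DD DM DA; rewrite /combination !DD !DM !DA; ring. Qed.

Lemma tangent_tensor_local (D : L -> L) :
    (forall a, D (tau a) = tau (ddiff s a)) ->
  tens_map tau (tangent_tensor s (open_x (nbhd_eqns U)) (open_y (nbhd_eqns U))) =
  tangent_pair D x_local y_local.
Proof.
move=> D_tau; rewrite /tangent_tensor tens_map_to_localB !tens_map_to_localM !tens_map_delta.
by rewrite !tens_map_to_local_pure to_local1 -!D_tau.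
Qed.

(** [tangent_pair] is bilinear and alternating, and a constant coordinate contributes
    nothing, so that only the determinant of the change of coordinates remains. *)
Lemma tangent_pair_change (D : L -> L) (sigma : L) a1 b1 c1 a2 b2 c2 :
    {morph D : f g / f + g} -> (forall f g, D (f * g) = f * D g + g * D f) ->
    (forall k : R, D k%:A = 0) ->
  tangent_pair (fun f => sigma * D f) (combination a1 b1 c1) (combination a2 b2 c2) =
  (1 \ox (sigma * (b1 * c2 - c1 * b2)%:A)) * tangent_pair D x_local y_local.
Proof.
move=> DD DM DA; rewrite /tangent_pair !delta_combination !derivation_combination //.
by rewrite scalarB !scalarM !tensrM !tensDr tensNr !tensrM; ring.
Qed.

End Conclusion.

Theorem theorem4p5 (R : realType) (F : {poly {poly R}})
    (F_irr : irreducible_elt F) (F_notline : ~ is_line F)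
    (K : fieldAlgType R) (x y : K) (K_fun : function_field F x y)
    (xi : real_point x y) (U : affine_nbhd xi)
    (s : coord_ring U) (s_free : kaehler_free s)
    (v : K -> int) (v_xi : valuation_centered xi v)
    (m n : nat) (lt0m : (1 <= m)%N) (ltmn : (m < n)%N)
    (mn_values : value_set x y v m n)
    (t : local_ring xi) (t_unif : uniformizer v t) :
  let T := tens_map (@to_local _ _ _ _ _ U)
             (tangent_tensor s (open_x (nbhd_eqns U)) (open_y (nbhd_eqns U))) in
  exists (sgn : bool) (u1 u2 : local_ring xi)
         (alpha beta : 'I_n.-1 -> tensor (local_ring xi) (local_ring xi)),
    (forall i, 0 < eval_at2 (alpha i) /\ 0 < eval_at2 (beta i)) /\
    (-1) ^+ sgn * T =
      (1 \ox t ^+ m.-1) *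
      \sum_(i < n.-1) (t ^+ i \ox t ^+ (n - 2 - i)) *
        (alpha i * delta u1 ^+ 2 + beta i * delta u2 ^+ 2).
Proof.
move=> T.
have [a1 [b1 [c1 [a2 [b2 [c2 [v1 f1 v2 f2 [det0 cx0]]]]]]]] :=
  adapted_coordinates v_xi U lt0m ltmn mn_values.
have [F0 _ _] := F_irr.
have xyF : biv (x_local U) (y_local U) F = 0.
  apply: val_inj; rewrite val_biv; apply: (K_fun.1 F).2.
  by exists 1; rewrite mul1r.
have xyK : generates (x_local U) (y_local U).
  move=> z; have [G [H [H0 ez]]] := K_fun.2 z; exists G, H.
  by rewrite -local_val_eq0 !val_biv.
have [H [xyH dH0]] := separable_relation cx0 F0 xyF.
have [p [q [p0 pq [G [pqG dG]]]]] := resolution v_xi cx0 xyK xyH dH0.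
have hgen := regular_delta_gen v_xi p0 pq pqG dG.
have [b hb] := regular_dq_dp pqG dG.
have [D [D_add D_mul D_alg D_tau]] := local_derivation s_free.
have [sigma hsigma] := delta_congr hgen hb (to_local s).
have sDp : sigma * D p = 1.
  by rewrite -(derivation_congr D_add D_mul D_alg hsigma) D_tau ddiff_s // to_local1.
(* [E] is the derivation with [E p = 1]. *)
pose E f := sigma * D f.
have E_add : {morph E : f g / f + g} by move=> f g; rewrite /E D_add mulrDr.
have E_mul f g : E (f * g) = f * E g + g * E f by rewrite /E D_mul; ring.
have delta_E f : diag_squares p q (delta f - (1 \ox E f) * delta p).
  have [c hc] := delta_congr hgen hb f.
  by rewrite /E (derivation_congr D_add D_mul D_alg hc) mulrCA sDp mulr1.
have [h [h0 et]] := uniformizer_factor v_xi p0 pq pqG dG t_unif.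
have evt : point_eval t = 0.
  by rewrite et point_evalM point_eval_centered mul0r.
have Et_unit : exists w, E t * w = 1.
  apply: local_unit.
  have -> : E t = h + centered p * E h.
    have Ep : E (centered p) = 1.
      have := D_add (centered p) (point_eval p)%:A; rewrite subrK D_alg addr0 => e.
      by rewrite /E -e.
    by rewrite et E_mul Ep mulr1 addrC.
  rewrite (raddfD (@point_eval _ _ _ _ xi)) /= (point_evalM (centered p)).
  by rewrite point_eval_centered mul0r addr0.
have [a [a0 ea]] := factor_uniformizer v_xi p0 pq pqG dG t_unif f1 v1.
have [c [c0 ec]] := factor_uniformizer v_xi p0 pq pqG dG t_unif f2 v2.
pose rho : tensor (local_ring xi) (local_ring xi) :=
  1 \ox (D p * (b1 * c2 - c1 * b2)^-1%:A).
have eT : T = rho * tangent_pair E (t ^+ m * a) (t ^+ n * c).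
  rewrite -ea -ec (tangent_pair_change U sigma _ _ _ _ _ _ D_add D_mul D_alg).
  rewrite /T (tangent_tensor_local D_tau) mulrA -tensrM.
  rewrite (_ : _ * (sigma * _) = (sigma * D p) *
    (((b1 * c2 - c1 * b2)^-1)%:A * (b1 * c2 - c1 * b2)%:A)); last by ring.
  by rewrite sDp mul1r -scalarM mulVf // scale1r tens11 mul1r.
have rho0 : eval_at2 rho != 0.
  rewrite eval_at2E point_eval1 mul1r point_evalM point_eval_alg.
  apply: mulf_neq0; last by rewrite invr_eq0.
  by apply: (@point_eval_unit _ _ _ _ _ _ sigma); rewrite mulrC.
have [sgn [alpha [beta [pos eq]]]] := signed_normal_form
  (@point_eval_alg _ _ _ _ xi) (@eval_at2E _ _ _ _ xi) E_mul delta_E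
  evt Et_unit lt0m ltmn rho0 a0 c0.
by exists sgn, p, q, alpha, beta; split=> //; rewrite eT.
Qed.
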